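(* The map $\nu\mapsto C(\nu)$ is continuous on $\mathcal{M}_1^b$ for the metric $$d(\nu_1,\nu_2)=\max\big(d_{LP}(\nu_1,\nu_2),\ |M_{\nu_1}-M_{\nu_2}|\big).$$
   Context: The space $\{-\infty\}\cup\mathbb{R}$ carries its usual topology and Borel $\sigma$-algebra; $\mathcal{M}_1$ is the set of all probability distributions on it. For $\nu\in\mathcal{M}_1$, $M_\nu=\inf\{t\in\mathbb{R} : \nu([t,+\infty))=0\}$ is the essential supremum of $\nu$, and $\mathcal{M}_1^b$ is the set of $\nu\in\mathcal{M}_1$ with finite essential supremum $M_\nu$. $d_{LP}$ is the L\'evy–Prokhorov metric on $\mathcal{M}_1$, which metrizes the weak convergence of probability measures on $\{-\infty\}\cup\mathbb{R}$. For $\nu\in\mathcal{M}_1$, let $(X_{i,j})_{0\le i<j}$ be i.i.d. random variables with distribution $\nu$, where $X_{i,j}$ is the weight of the directed edge $(i,j)$ of the complete directed acyclic graph on the non-negative integers. A directed path is a sequence of integers $\pi=(i_1,\dots,i_k)$ with $0\le i_1<\dots<i_k$; its weight is $w_\pi=X_{i_1,i_2}+\dots+X_{i_{k-1},i_k}$. Let $W_n=\max\{w_\pi : \pi=(i_1,\dots,i_k) \text{ a directed path with } i_1=0,\ i_k=n\}$. Then $W_n/n$ converges almost surely to a deterministic constant $C(\nu)\in\mathbb{R}\cup\{\pm\infty\}$, called the time constant for last passage percolation. *)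

(* Defs.v *)
From HB Require Import structures.
From mathcomp Require Import all_boot all_order all_algebra.
From mathcomp Require Import all_classical all_reals all_analysis.
From mathcomp Require Import measurable_realfun.

Set Implicit Arguments.
Unset Strict Implicit.
Unset Printing Implicit Defensive.

Import Order.TTheory GRing.Theory Num.Theory.
Import numFieldNormedType.Exports.

Local Open Scope classical_set_scope.
Local Open Scope ring_scope.
Local Open Scope ereal_scope.

(* {-oo} U R, as an (open) subspace of \bar R.  A Borel probability on it is
   represented by a probability on \bar R that does not charge +oo. *)
Definition lowR (R : realType) : set (\bar R) := [set~ +oo].

Definition M1 (R : realType) : set (probability (\bar R) R) :=
  [set nu | nu [set +oo] = 0].

Definition esssup (R : realType) (nu : probability (\bar R) R) : \bar R :=
  ereal_inf [set t%:E | t in [set t : R | nu [set x | t%:E <= x < +oo] = 0]].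

Definition M1b (R : realType) : set (probability (\bar R) R) :=
  [set nu | M1 nu /\ esssup nu \is a fin_num].

(* rho is a metric on {-oo} U R inducing its usual topology; the values of rho
   at +oo are irrelevant. *)
Definition compatible_metric (R : realType) (rho : \bar R -> \bar R -> R) :=
  [/\ {in @lowR R &, forall x y, rho x y = 0%R <-> x = y},
      {in @lowR R &, forall x y, rho x y = rho y x},
      {in @lowR R & &, forall x y z, (rho x z <= rho x y + rho y z)%R} &
      forall (x : \bar R) (V : set (\bar R)), lowR x ->
        within (@lowR R) (nbhs x) V <->
        exists2 e : R, (0 < e)%R &
          forall y, lowR y -> (rho x y < e)%R -> V y].

Definition thickening (R : realType) (rho : \bar R -> \bar R -> R) (e : R)
    (A : set (\bar R)) : set (\bar R) :=
  [set y | lowR y /\ exists2 x, A x & (rho x y < e)%R].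

Definition levy_prokhorov (R : realType) (rho : \bar R -> \bar R -> R)
    (mu nu : probability (\bar R) R) : R :=
  inf [set e : R | (0 < e)%R /\
    forall A : set (\bar R), measurable A -> A `<=` @lowR R ->
      mu A <= nu (thickening rho e A) + e%:E /\
      nu A <= mu (thickening rho e A) + e%:E].

Definition M1b_dist (R : realType) (rho : \bar R -> \bar R -> R)
    (nu1 nu2 : probability (\bar R) R) : R :=
  Num.max (levy_prokhorov rho nu1 nu2)
          `|fine (esssup nu1) - fine (esssup nu2)|%R.

Definition directed_path (i j : nat) (p : seq nat) : Prop :=
  [/\ ohead p = Some i, last i p = j & sorted ltn p].

Definition path_weight (R : realType) (x : nat -> nat -> \bar R)
    (p : seq nat) : \bar R :=
  \sum_(e <- zip p (behead p)) x e.1 e.2.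

(* The supremum runs over a finite nonempty set, hence is a maximum. *)
Definition last_passage (R : realType) (x : nat -> nat -> \bar R) (n : nat)
    : \bar R :=
  ereal_sup [set path_weight x p | p in [set p | directed_path 0 n p]].

(* Mutual independence of (X i j), i < j, and common law nu.  The entries
   X i j with j <= i play no role. *)
Definition iid_weights (R : realType) (nu : probability (\bar R) R)
    (d : measure_display) (Omega : measurableType d) (P : probability Omega R)
    (X : nat -> nat -> {RV P >-> \bar R}) : Prop :=
  (forall i j, (i < j)%N -> forall A, measurable A ->
     distribution P (X i j) A = nu A) /\
  (forall (s : seq (nat * nat)) (A : nat * nat -> set (\bar R)),
     uniq s -> all (fun e => e.1 < e.2)%N s ->
     (forall e, measurable (A e)) ->
     P (\big[setI/setT]_(e <- s) (X e.1 e.2 @^-1` A e)) =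
     \prod_(e <- s) P (X e.1 e.2 @^-1` A e)).

Definition is_time_constant (R : realType) (nu : probability (\bar R) R)
    (c : \bar R) : Prop :=
  forall (d : measure_display) (Omega : measurableType d)
    (P : probability Omega R) (X : nat -> nat -> {RV P >-> \bar R}),
    iid_weights nu X ->
    {ae P, forall w : Omega,
      (fun n => last_passage (fun i j => X i j w) n * (n%:R^-1)%:E) @ \oo
        --> c}.

(* Main.v *)
Require Import Defs.
From HB Require Import structures.
From mathcomp Require Import all_boot all_order all_algebra.
From mathcomp Require Import all_classical all_reals all_analysis.
From mathcomp Require Import measurable_realfun.
From mathcomp Require Import ring lra zify.
Import numFieldNormedType.Exports.

(* Let H(I) be the largest weight of a path with all its vertices in the
   interval I, endpoints being free.  It is subadditive up to a constant: cut a
   path at the boundary of two adjacent intervals.  It is also superadditive up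
   to O(k) in mean on intervals of length 2^k: an optimal path of the left
   interval is joined to one of the right interval through a buffer of O(k)
   vertices, where some vertex offers two edges that are not too negative, except
   with exponentially small probability.  The same surgery at both ends shows that
   E[H] / length converges to the time constant, and summing the errors over the
   scales shows that E[H(2^j)] / 2^j approximates it with an error
   O((j + 1) / 2^j), uniformly over laws close to nu: the implied constant only
   depends on an upper bound of the support and on a lower bound for the mass of
   some [-K, +oo).  At a fixed scale j the mean of H is continuous: all laws are
   realized by quantile transforms of common uniform variables, built from the
   binary digits of a uniform point of [0, 1], and a small Levy-Prokhorov
   distance makes the two weights of each edge close (or both very negative)
   with high probability. *)

(** * Free-endpoint maxima *)

(** The weight [W_n] has fixed endpoints: it can be -oo with positive probability, and the negative
    part of the law need not be integrable, so its mean may carry no information. Freeing the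
    endpoints yields a bounded nonnegative variable whose mean always exists. Subadditivity alone
    would present the time constant as an infimum of continuous functions and give only upper
    semicontinuity. The reverse inequality, with an error O(k) at scale k, makes the dyadic means
    converge uniformly over neighbouring laws, because (k + 1) / 2^k is summable; continuity then
    passes to the limit. The two parts of the metric play different roles. Weak closeness does not
    see a small mass placed far to the right, so the distance between essential suprema supplies the
    common upper bound B; the Levy-Prokhorov distance supplies the common mass of [-K, +oo) and the
    closeness of the weights. A time constant is a statement about every realization of the weights,
    so it can be tested on the single one built on [0, 1]. *)

Section block_maximum.
Set Implicit Arguments.
Unset Strict Implicit.
Import Order.TTheory GRing.Theory Num.Theory.
Local Open Scope ring_scope.
Context {R : realType}.
Implicit Types (x y : nat -> nat -> \bar R) (p q s : seq nat) (B K : R).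

Definition path_edges p := zip p (behead p).

Definition open_path x p := all (fun e => x e.1 e.2 != -oo%E) (path_edges p).

(** The guard is essential: [fine] sends -oo to 0, so a forbidden edge would otherwise count as
    free. The default 0 is the value of the empty path, hence it never changes the maximum below. *)
Definition path_value x p : R :=
  if open_path x p then \sum_(e <- path_edges p) fine (x e.1 e.2) else 0.

(* Endpoints are free, so that block_max is bounded, nonnegative, and almost
   additive under concatenation of blocks. *)
Definition block_max x s : R :=
  \big[Num.max/0]_(m : (size s).-tuple bool) path_value x (mask m s).

Lemma path_edges_cat p b a q :
  path_edges (rcons p b ++ a :: q) =
  path_edges (rcons p b) ++ (b, a) :: path_edges (a :: q).
Proof.
elim: p => [|c p IH] //=.
by case: p IH => [|d p] //=; rewrite /path_edges /= => ->.
Qed.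

Lemma size_path_edges p : size (path_edges p) = (size p).-1.
Proof. by rewrite /path_edges size_zip size_behead; lia. Qed.

Lemma path_edges_mem p e : e \in path_edges p -> (e.1 \in p) && (e.2 \in p).
Proof.
case: e => i j /(nthP (0%N, 0%N)) [k]; rewrite size_path_edges => kp.
rewrite /path_edges nth_zip_cond size_zip size_behead.
have -> : (k < minn (size p) (size p).-1)%N by lia.
case=> <- <-; rewrite nth_behead; apply/andP; split; apply: mem_nth.
  exact: leq_trans kp (leq_pred _).
by move: kp; case: (size p).
Qed.

Lemma open_path_cat x p b a q :
  open_path x (rcons p b ++ a :: q) =
  [&& open_path x (rcons p b), x b a != -oo%E & open_path x (a :: q)].
Proof. by rewrite /open_path path_edges_cat all_cat. Qed.

Lemma path_value_cat x p b a q : open_path x (rcons p b ++ a :: q) ->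
  path_value x (rcons p b ++ a :: q) =
  path_value x (rcons p b) + fine (x b a) + path_value x (a :: q).
Proof.
move=> op; have := op; rewrite open_path_cat => /and3P[op1 _ op2].
by rewrite /path_value op op1 op2 path_edges_cat big_cat big_cons /= addrA.
Qed.

Lemma path_value_le_size x B p : 0 <= B -> (forall i j, (x i j <= B%:E)%E) ->
  path_value x p <= (size p).-1%:R * B.
Proof.
move=> B0 xB; rewrite /path_value; case: ifPn => op; last by rewrite mulr_ge0.
rewrite -size_path_edges mulr_natl.
have /= : forall r : seq (nat * nat), all (fun e => x e.1 e.2 != -oo%E) r ->
    \sum_(e <- r) fine (x e.1 e.2) <= B *+ size r.
  elim=> [_|e r IH /= /andP[e1 /IH]]; first by rewrite big_nil.
  rewrite big_cons mulrS; apply: lerD.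
  by have := xB e.1 e.2; case: (x _ _) e1.
exact.
Qed.

Lemma block_max_ge0 x s : 0 <= block_max x s.
Proof. exact: bigmax_ge_id. Qed.

Lemma path_value_le_block_max x p s : subseq p s ->
  path_value x p <= block_max x s.
Proof.
move=> /subseqP[m sm ->]; rewrite /block_max.
have /eqP sm' := sm.
by rewrite (bigD1 (Tuple sm')) //= le_max lexx.
Qed.

(** If the maximum comes from a path with a forbidden edge, its value is the default 0, and the
    empty path, which is open, is an equally good witness. *)
Lemma block_max_attained x s :
  exists p, [/\ subseq p s, open_path x p & block_max x s = path_value x p].
Proof.
have [p sp ->] : exists2 p, subseq p s & block_max x s = path_value x p.
  rewrite /block_max; elim/big_ind: _.
  - by exists [::]; rewrite ?sub0seq // /path_value /= big_nil.
  - move=> _ _ [p sp ->] [q sq ->].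
    by case: (leP (path_value x p) (path_value x q)) => _; [exists q|exists p].
  - by move=> m _; exists (mask m s) => //; exact: mask_subseq.
have [op|op] := boolP (open_path x p); first by exists p.
exists [::]; split => //; first exact: sub0seq.
by rewrite /path_value (negbTE op) /= big_nil.
Qed.

Lemma block_max_subseq x s s' : subseq s s' -> block_max x s <= block_max x s'.
Proof.
move=> ss'; have [p [sp _ ->]] := block_max_attained x s.
exact/path_value_le_block_max/(subseq_trans sp).
Qed.

Lemma block_max_le_size x B s : 0 <= B -> (forall i j, (x i j <= B%:E)%E) ->
  block_max x s <= (size s)%:R * B.
Proof.
move=> B0 xB; have [p [sp _ ->]] := block_max_attained x s.
apply: (le_trans (path_value_le_size p B0 xB)).
by rewrite ler_wpM2r // ler_nat (leq_trans (leq_pred _)) // size_subseq.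
Qed.

Lemma subseq_catE p s1 s2 : subseq p (s1 ++ s2) ->
  exists p1 p2, [/\ p = p1 ++ p2, subseq p1 s1 & subseq p2 s2].
Proof.
move=> /subseqP[m sm ->].
exists (mask (take (size s1) m) s1), (mask (drop (size s1) m) s2).
rewrite !mask_subseq -mask_cat ?cat_take_drop // size_take sm size_cat.
by case: ltnP => //; case: (size s2) => [|k]; rewrite ?addn0 // addnS ltnNge leq_addr.
Qed.

Lemma block_max_cat_le x B s1 s2 : 0 <= B -> (forall i j, (x i j <= B%:E)%E) ->
  block_max x (s1 ++ s2) <= block_max x s1 + B + block_max x s2.
Proof.
move=> B0 xB; have [p [sp op ->]] := block_max_attained x (s1 ++ s2).
have [p1 [p2 [pE sp1 sp2]]] := subseq_catE sp.
have H1 := path_value_le_block_max x sp1.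
have H2 := path_value_le_block_max x sp2.
have G1 := block_max_ge0 x s1; have G2 := block_max_ge0 x s2.
case: p2 pE sp2 H2 => [|a q] pE sp2 H2; first by rewrite pE cats0; lra.
case/lastP: p1 pE sp1 H1 => [|r b] pE sp1 H1; first by rewrite pE /=; lra.
move: op; rewrite pE => op; rewrite path_value_cat //.
suff : fine (x b a) <= B by lra.
move: op; rewrite open_path_cat => /and3P[_ n _].
by have := xB b a; case: (x b a) n.
Qed.

(** All pairs are required because the vertices to be joined, the end of one optimal path and the
    start of the other, depend on the weights. *)
Definition connected x K s1 s s2 := forall b a, b \in s1 -> a \in s2 ->
  exists2 v, v \in s & ((- K)%:E <= x b v)%E /\ ((- K)%:E <= x v a)%E.

Lemma fine_ge x B K i j : (forall i j, (x i j <= B%:E)%E) ->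
  ((- K)%:E <= x i j)%E -> - K <= fine (x i j) /\ x i j != -oo%E.
Proof.
by move=> /(_ i j); case: (x i j) => // r _; rewrite lee_fin.
Qed.

Lemma join_path x B K p b v a q : (forall i j, (x i j <= B%:E)%E) ->
  open_path x (rcons p b) -> open_path x (a :: q) ->
  ((- K)%:E <= x b v)%E -> ((- K)%:E <= x v a)%E ->
  let r := rcons p b ++ v :: a :: q in open_path x r /\
  path_value x (rcons p b) + path_value x (a :: q) - 2 * K <= path_value x r.
Proof.
move=> xB op1 op2 /(fine_ge xB)[bv bv'] /(fine_ge xB)[va va'] r.
have opv : open_path x [:: v & a :: q] by rewrite /open_path /= va'.
have op : open_path x r by rewrite open_path_cat op1 bv'.
split => //; rewrite path_value_cat // (@path_value_cat _ [::] v) //.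
have -> : path_value x (rcons [::] v) = 0 by rewrite /path_value /= big_nil.
by lra.
Qed.

Lemma block_max_join x B K s1 s s2 : 0 <= K -> (forall i j, (x i j <= B%:E)%E) ->
  connected x K s1 s s2 ->
  block_max x s1 + block_max x s2 - 2 * K <= block_max x (s1 ++ s ++ s2).
Proof.
move=> K0 xB con; have [p1 [sp1 op1 E1]] := block_max_attained x s1.
have [p2 [sp2 op2 E2]] := block_max_attained x s2.
have G1 := block_max_ge0 x s1; have G2 := block_max_ge0 x s2.
have pv0 : path_value x [::] = 0 by rewrite /path_value /= big_nil.
(* An empty optimal path has no endpoint to join; its value is 0, so monotonicity of the maximum and
   [0 <= K] suffice. *)
case: p2 sp2 op2 E2 => [|a q] sp2 op2 E2.
  by have := block_max_subseq x (prefix_subseq s1 (s ++ s2)); lra.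
case/lastP: p1 sp1 op1 E1 => [|r b] sp1 op1 E1.
  have := block_max_subseq x (suffix_subseq (s1 ++ s) s2); rewrite -catA; lra.
have b1 : b \in s1 by apply: (mem_subseq sp1); rewrite mem_rcons mem_head.
have a2 : a \in s2 by apply: (mem_subseq sp2); rewrite mem_head.
have [v vs [bv va]] := con b a b1 a2.
have [_ /le_trans] := join_path xB op1 op2 bv va.
rewrite E1 E2; apply; apply: path_value_le_block_max.
by rewrite cat_subseq // -cat1s cat_subseq // sub1seq.
Qed.

(* An optimal path has nonnegative weight and its edges are at most B, so they
   are at least -K: smaller weights play no role. *)
Lemma block_max_perturb x y B K eps s : 0 <= B -> 0 <= eps ->
  (forall i j, (x i j <= B%:E)%E) -> (forall i j, (y i j <= B%:E)%E) ->
  (size s)%:R * B <= K ->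
  (forall i j, i \in s -> j \in s -> ((- K)%:E <= x i j)%E ->
     (x i j <= y i j + eps%:E)%E) ->
  block_max x s <= block_max y s + (size s)%:R * eps.
Proof.
move=> B0 e0 xB yB KB xy; have [p [sp op E]] := block_max_attained x s.
have G := block_max_ge0 x s; rewrite {}E in G *.
have Gy := path_value_le_block_max y sp.
have szp := size_subseq sp.
have : forall e, e \in path_edges p -> - K <= fine (x e.1 e.2).
  (* The deficits [B - x e] are nonnegative and, as the whole path weighs at least 0, they add up to
     at most [K]; so each of them is at most [K]. *)
  have : \sum_(e <- path_edges p) (B - fine (x e.1 e.2)) <= K.
    rewrite sumrB big_const_seq count_predT iter_addr_0 size_path_edges -mulr_natl.
    move: G; rewrite /path_value op => G.
    suff : (size p).-1%:R * B <= (size s)%:R * B by lra.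
    by rewrite ler_wpM2r // ler_nat (leq_trans (leq_pred _)).
  move=> S e ep; rewrite -subr_ge0.
  have /andP[i1 i2] := path_edges_mem ep.
  have pos i j : x i j != -oo%E -> 0 <= B - fine (x i j).
    by have := xB i j; case: (x i j) => // r; rewrite lee_fin subr_ge0.
  have : B - fine (x e.1 e.2) <= \sum_(e <- path_edges p) (B - fine (x e.1 e.2)).
    rewrite (big_rem e) //= lerDl big_seq sumr_ge0 // => f /mem_rem fp.
    by apply: pos; move/allP: op => /(_ _ fp).
  by move: S; lra.
move=> lo.
have key e : e \in path_edges p ->
    y e.1 e.2 != -oo%E /\ fine (x e.1 e.2) <= fine (y e.1 e.2) + eps.
  move=> ep; have /andP[i1 i2] := path_edges_mem ep.
  have := lo e ep; have := xy _ _ (mem_subseq sp i1) (mem_subseq sp i2).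
  move/allP: op => /(_ _ ep); have := xB e.1 e.2; have := yB e.1 e.2.
  case: (x _ _) => // a; case: (y _ _) => // [b|] _ _ _ /=.
    by rewrite -EFinD !lee_fin => h /h.
  by rewrite !lee_fin => h /h.
have oy : open_path y p by apply/allP => e /key[].
move: Gy; rewrite /path_value op oy => Gy.
apply: (@le_trans _ _ (\sum_(e <- path_edges p) (fine (y e.1 e.2) + eps))).
  by rewrite big_seq [leRHS]big_seq; apply: ler_sum => e /key[].
rewrite big_split big_const_seq count_predT iter_addr_0 size_path_edges.
apply: lerD => //; rewrite -[leLHS]mulr_natl ler_wpM2r // ler_nat.
exact: leq_trans (leq_pred _) _.
Qed.

Lemma path_weightE x B p : (forall i j, (x i j <= B%:E)%E) ->
  path_weight x p = if open_path x p then (path_value x p)%:E else -oo%E.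
Proof.
move=> xB; rewrite /path_weight /path_value /open_path -/(path_edges p).
elim: (path_edges p) => [|e r IH] /=; first by rewrite !big_nil.
rewrite !big_cons IH; have := xB e.1 e.2.
case: (x _ _) => //= a _.
by case: (all _ r).
Qed.

(** A strictly increasing sequence is determined by its set of entries, so it is the interval
    filtered by membership. *)
Lemma directed_path_subseq n p : directed_path 0 n p -> subseq p (iota 0 n.+1).
Proof.
move=> [hp lp sp].
have pn i : i \in p -> (i <= n)%N.
  case/lastP: p hp lp sp => // p l _; rewrite last_rcons => -> sp.
  rewrite mem_rcons inE => /orP[/eqP -> //|ip].
  have : pairwise ltn (rcons p n) by rewrite -sorted_pairwise //; exact: ltn_trans.
  by rewrite pairwise_rcons => /andP[/allP /(_ _ ip) /= /ltnW].
suff -> : p = [seq i <- iota 0 n.+1 | i \in p] by exact: filter_subseq.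
apply: (irr_sorted_eq ltn_trans ltnn) => //.
  by apply: sorted_filter; [exact: ltn_trans|exact: iota_ltn_sorted].
by move=> i; rewrite mem_filter mem_iota /= add0n ltnS; case: (boolP (i \in p)) => // /pn ->.
Qed.

Lemma last_passage_le x B n : (forall i j, (x i j <= B%:E)%E) ->
  (last_passage x n <= (block_max x (iota 0 n.+1))%:E)%E.
Proof.
move=> xB; apply: ge_ereal_sup => _ [p /directed_path_subseq sp <-].
rewrite (path_weightE p xB); case: ifP => // _; last by rewrite leNye.
by rewrite lee_fin path_value_le_block_max.
Qed.

(** The vertices are laid out as 0, a buffer, the middle block, a second buffer and [n]. Each
    endpoint is attached through two edges of weight at least [- K], whence [4 * K]. *)
Lemma last_passage_ge x B K L l n : 0 <= K -> (forall i j, (x i j <= B%:E)%E) ->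
  (0 < l)%N -> n = (L + l + L).+1 ->
  connected x K [:: 0%N] (iota 1 L) (iota (1 + L) l) ->
  connected x K (iota (1 + L) l) (iota (1 + L + l) L) [:: n] ->
  ((block_max x (iota (1 + L) l) - 4 * K)%:E <= last_passage x n)%E.
Proof.
move=> K0 xB l0 nE c1 c2; set s := iota (1 + L) l.
(* Attaching the endpoints requires a first and a last vertex. An empty optimal path is replaced by
   the first vertex of the block, also of value 0; this is where [0 < l] enters. *)
have [p [ps op Ep]] : exists p, [/\ subseq p s /\ p != [::], open_path x p &
    block_max x s = path_value x p].
  have [p [sp op E]] := block_max_attained x s.
  have [p0|?] := eqVneq p [::]; last by exists p.
  exists [:: 1 + L]%N; split => //.
    by rewrite sub1seq mem_iota; split => //; lia.
  by rewrite E p0 /path_value /= !big_nil.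
case: ps => ps.
case: p ps op Ep => // a q ps op Ep _.
have as_ : a \in s by apply: (mem_subseq ps); rewrite mem_head.
have [v vs [v1 v2]] := c1 0%N a (mem_head _ _) as_.
have [op1 le1] := @join_path x B K [::] 0%N v a q xB isT op v1 v2.
set b := last a q.
have bs : b \in s by apply: (mem_subseq ps); exact: mem_last.
have [w ws [w1 w2]] := c2 b n bs (mem_head _ _).
move: op1 le1; set r := _ ++ _ => op1 le1.
have rE : r = rcons (belast 0%N [:: v, a & q]) b.
  by rewrite /r /= -lastI.
rewrite rE in op1 le1.
have [op2 le2] := @join_path x B K _ b w n [::] xB op1 isT w1 w2.
have pv1 i : path_value x [:: i] = 0 by rewrite /path_value /= big_nil.
rewrite pv1 in le2; rewrite pv1 in le1.
apply: (@le_trans _ _ (path_weight x (r ++ [:: w; n]))).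
  by rewrite (path_weightE _ xB) rE op2 lee_fin Ep; lra.
apply: ereal_sup_ubound.
exists (r ++ [:: w; n]) => //; split => //; first by rewrite /= last_cat.
have S : sorted ltn (a :: q) by apply: (subseq_sorted ltn_trans ps); exact: iota_ltn_sorted.
rewrite /r -cat1s /= cat_path /= -/b.
move: as_ bs ws vs; rewrite !mem_iota => as_ bs ws vs.
move: S => /= ->; rewrite -/b.
case/andP: as_ bs ws vs => aL _ /andP[_ bl] /andP[lw wn] /andP[-> vL].
by rewrite (leq_trans vL aL) (leq_trans bl lw) nE (leq_trans wn) // add1n !addSn.
Qed.

End block_maximum.

(** * Independent uniform variables *)

Section fair_bits.
Set Implicit Arguments.
Unset Strict Implicit.
Import Order.TTheory GRing.Theory Num.Theory.
Local Open Scope classical_set_scope.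
Local Open Scope ring_scope.
Context {R : realType}.
Local Notation T := (measurableTypeR R).

Definition unit_prob : probability T R := uniform_prob (@ltr01 R).
Local Notation P := unit_prob.

Lemma unit_prob_itv (a b : R) : 0 <= a -> a <= b -> b <= 1 ->
  P `[a, b[%classic = (b - a)%:E.
Proof.
move=> a0 ab b1; rewrite /unit_prob /= /uniform_prob.
rewrite (eq_integral (cst 1%E)); last first.
  move=> x; rewrite inE /= in_itv /= /uniform_pdf => /andP[ax xb].
  by rewrite (le_trans a0 ax) (le_trans (ltW xb) b1) /= subr0 invr1.
rewrite integral_cst //= mul1e lebesgue_measure_itv /= lte_fin.
by case: ltgtP ab => // -> _; rewrite subrr.
Qed.

Definition bit (k : nat) (w : T) : bool := odd (Num.truncn (2 ^+ k.+1 * w)).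

Lemma measurable_bit k b : measurable [set w | bit k w = b].
Proof.
have mt : measurable [set w | bit k w = true].
  rewrite (_ : [set w | _] = \bigcup_n
     `[(n.*2.+1)%:R / 2 ^+ k.+1, (n.*2.+2)%:R / 2 ^+ k.+1 [%classic).
    by apply: bigcup_measurable.
  have e0 : 0 < 2 ^+ k.+1 :> R by rewrite exprn_gt0.
  apply/seteqP; split => w /=.
    move=> bw; have w0 : 0 <= 2 ^+ k.+1 * w.
      rewrite leNgt; apply/negP => w0; move: bw; rewrite /bit.
      rewrite (_ : Num.truncn _ = 0%N) //; apply/Num.Theory.truncn0Pn.
      by rewrite -ltNge (lt_trans w0).
    exists (Num.truncn (2 ^+ k.+1 * w))./2 => //=.
    rewrite in_itv /= ler_pdivrMr // ltr_pdivlMr // [w * _]mulrC.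
    have /eqP := erefl (Num.truncn (2 ^+ k.+1 * w)).
    rewrite Num.Theory.truncn_eq // => /andP[h1 h2].
    have E : ((Num.truncn (2 ^+ k.+1 * w))./2.*2.+1 = Num.truncn (2 ^+ k.+1 * w))%N.
      by rewrite -[RHS]odd_double_half; move: bw; rewrite /bit => ->.
    by rewrite E h1 h2.
  move=> [n _ /=]; rewrite in_itv /= ler_pdivrMr // ltr_pdivlMr // mulrC => h.
  by rewrite /bit (Num.Theory.truncn_def h) /= odd_double.
case: b => //; rewrite (_ : [set w | _] = ~` [set w | bit k w = true]).
  exact: measurableC.
by apply/seteqP; split => w /=; case: (bit k w).
Qed.

Definition bits_value (s : seq bool) : nat :=
  foldl (fun (m : nat) (b : bool) => (m.*2 + b)%N) 0%N s.

(** The points of [0, 1) whose binary expansion starts with [s], most significant digit first. The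
    interval is closed on the left to agree with the rounding down in [bit]. *)
Definition bits_itv (s : seq bool) : set T :=
  `[(bits_value s)%:R / 2 ^+ size s, (bits_value s).+1%:R / 2 ^+ size s[%classic.

Lemma bits_itv_rcons s b :
  bits_itv (rcons s b) = bits_itv s `&` [set w | bit (size s) w = b].
Proof.
have e0 n : 0 < 2 ^+ n :> R by rewrite exprn_gt0.
rewrite /bits_itv /bits_value foldl_rcons -/(bits_value s) size_rcons.
apply/seteqP; split => w /=; rewrite !in_itv /= !ler_pdivrMr // !ltr_pdivlMr //.
  move=> h; split; last first.
    by rewrite /bit [_ * w]mulrC (Num.Theory.truncn_def h) oddD odd_double; case: (b).
  move: h; rewrite exprS -(@natr1 _ (_ + _)%N) -(@natr1 _ (bits_value s)) natrD -muln2 natrM.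
  have : 0 <= (b%:R : R) <= 1 by case: (b); rewrite /= ?ler01 ?lexx.
  by nra.
move=> [/andP[h1 h2] bw].
have w0 : 0 <= 2 ^+ (size s).+1 * w.
  by rewrite exprS -mulrA mulr_ge0 // mulrC; apply: le_trans h1.
move: bw; rewrite /bit; set t := Num.truncn _ => bt.
have /eqP : Num.truncn (2 ^+ (size s).+1 * w) = t by [].
rewrite Num.Theory.truncn_eq // => /andP[h3 h4].
have t1 : ((bits_value s).*2 <= t)%N.
  rewrite -ltnS -(ltr_nat R); apply: le_lt_trans h4.
  by rewrite exprS -muln2 natrM; nra.
have t2 : (t < (bits_value s).*2.+2)%N.
  rewrite -(ltr_nat R); apply: le_lt_trans h3 _.
  by move: h2; rewrite exprS -doubleS -muln2 natrM; nra.
suff -> : ((bits_value s).*2 + b = t)%N by rewrite [w * _]mulrC h3 h4.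
by rewrite -bt; move: t1 t2; clear; lia.
Qed.

Lemma bits_value_lt s : (bits_value s < 2 ^ size s)%N.
Proof.
elim/last_ind: s => // s b IH.
rewrite /bits_value foldl_rcons -/(bits_value s) size_rcons expnS.
by case: b; move: IH; lia.
Qed.

Lemma unit_prob_bits_itv s : P (bits_itv s) = ((2 ^+ size s)^-1)%:E.
Proof.
have e0 n : 0 < 2 ^+ n :> R by rewrite exprn_gt0.
rewrite unit_prob_itv.
- by rewrite -mulrBl -natr1 addrC addKr mul1r.
- by rewrite divr_ge0.
- by rewrite ler_pM2r ?invr_gt0 // ler_nat.
- by rewrite ler_pdivrMr // mul1r -natrX ler_nat bits_value_lt.
Qed.

(** [None] leaves a digit free. The lower end [n] of the window lets an induction consume the
    leading digits, which are then recorded in a dyadic interval. *)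
Definition cylinder (c : nat -> option bool) n m : set T :=
  [set w | forall j, (n <= j < m)%N -> forall b, c j = Some b -> bit j w = b].

Lemma measurable_cylinder c n m : measurable (cylinder c n m).
Proof.
rewrite (_ : cylinder c n m = \bigcap_(j in [set j | (n <= j < m)%N])
    [set w | forall b, c j = Some b -> bit j w = b]) //.
apply: bigcap_measurableType => j _; case: (c j) => [b|].
  rewrite (_ : [set w | _] = [set w | bit j w = b]); first exact: measurable_bit.
  by apply/seteqP; split => w /= => [|-> _ [<-]//]; exact.
by rewrite (_ : [set w | _] = setT) //; apply/seteqP.
Qed.

Lemma measurable_bits_itv s : measurable (bits_itv s).
Proof. exact: measurable_itv. Qed.

Lemma unit_prob_bit_split i A : measurable A ->
  P A = (P (A `&` [set w | bit i w = false]) + P (A `&` [set w | bit i w = true]))%E.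
Proof.
move=> mA; rewrite (measureDI P mA (measurable_bit i true)); congr (P _ + _)%E.
by apply/seteqP; split => w /= [Aw]; case: (bit i w).
Qed.

(** Induction on the number of remaining digits, for all prefixes at once: a prescribed digit
    lengthens the prefix, a free one splits the event into two parts of equal probability. *)
Lemma unit_prob_cylinder_bits c m s :
  P (bits_itv s `&` cylinder c (size s) (size s + m)) =
  ((2 ^+ size s)^-1 *
   \prod_(size s <= j < size s + m) if c j is Some _ then 2^-1 else 1)%:E.
Proof.
elim: m s => [|m IH] s.
  rewrite addn0 big_geq // mulr1 -unit_prob_bits_itv; congr (P _).
  apply/seteqP; split => w /=; first by case.
  by move=> ws; split => // j; rewrite ltnNge andbN.
rewrite big_ltn ?addnS ?ltnS ?leq_addr // -addSn.
have step b : P (bits_itv s `&` [set w | bit (size s) w = b] `&`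
     cylinder c (size s).+1 ((size s).+1 + m)) =
  ((2 ^+ size s)^-1 * (2^-1 *
   \prod_((size s).+1 <= j < (size s).+1 + m) if c j is Some _ then 2^-1 else 1))%:E.
  have := IH (rcons s b); rewrite bits_itv_rcons size_rcons => ->.
  by rewrite exprS invfM mulrA [_^-1 / _]mulrC.
have cylE b : (if c (size s) is Some b' then b == b' else true) ->
    bits_itv s `&` cylinder c (size s) ((size s).+1 + m) `&` [set w | bit (size s) w = b] =
    bits_itv s `&` [set w | bit (size s) w = b] `&`
     cylinder c (size s).+1 ((size s).+1 + m).
  move=> cb; apply/seteqP; split => w.
    move=> [[ws wc] wb]; split => // j /andP[sj jm] b' cj.
    by apply: wc cj; rewrite jm (ltnW sj).
  move=> [[ws wb] wc]; split => //; split => // j /andP[].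
  rewrite leq_eqVlt => /orP[/eqP <- _ b'|sj jm b' cj].
    by move=> E; move: cb; rewrite E wb => /eqP.
  by apply: wc cj; rewrite sj.
have mA : measurable (bits_itv s `&` cylinder c (size s) ((size s).+1 + m)).
  by apply: measurableI; [exact: measurable_bits_itv|exact: measurable_cylinder].
case E : (c (size s)) => [b|].
  rewrite -(step b) -cylE ?E //; congr (P _); apply/seteqP; split => [w [ws wc]|w []//].
  by split => //; apply: wc E; rewrite leqnn leq_addr.
rewrite (unit_prob_bit_split (size s) mA) !cylE ?E // !step -EFinD mul1r.
by congr (_%:E); field; rewrite expf_neq0.
Qed.

Lemma unit_prob_cylinder c m : P (cylinder c 0 m) =
  (\prod_(0 <= j < m) if c j is Some _ then 2^-1 else 1)%:E.
Proof.
have := unit_prob_cylinder_bits c m [::].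
rewrite add0n expr0 invr1 mul1r => <-.
(* The empty prefix describes [0, 1), which carries all the mass; the part of the cylinder outside
   is null. *)
have D1 : P (bits_itv [::]) = 1%E by rewrite unit_prob_bits_itv expr0 invr1.
have mc := measurable_cylinder c 0 m; have md := measurable_bits_itv [::].
have D0 : P (~` bits_itv [::]) = 0%E by rewrite (probability_setC P md) D1 subee.
rewrite (measureDI P mc md) [in RHS]setIC -[RHS]add0e; congr (_ + _)%E.
apply: (@subset_measure0 _ _ _ P _ (~` bits_itv [::])).
- exact: measurableD.
- exact: measurableC.
- by move=> w [].
- exact: D0.
Qed.

Definition fix_bit (c : nat -> option bool) i b j := if j == i then Some b else c j.

Lemma cylinder_fix_bit c m i b : (i < m)%N -> c i = None ->
  cylinder (fix_bit c i b) 0 m = cylinder c 0 m `&` [set w | bit i w = b].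
Proof.
move=> im ci; apply/seteqP; split => w.
  move=> wc; split; last by apply: (wc i) => //; rewrite /fix_bit eqxx.
  move=> j jm b' cj; apply: (wc j) => //; rewrite /fix_bit.
  by case: eqP cj => // ->; rewrite ci.
move=> [wc wb] j jm b'; rewrite /fix_bit.
by case: eqP => [-> [<-]//|_]; exact: wc.
Qed.

Lemma unit_prob_fix_bit c m i b : (i < m)%N -> c i = None ->
  P (cylinder (fix_bit c i b) 0 m) = (2^-1%:E * P (cylinder c 0 m))%E.
Proof.
move=> im ci; rewrite !unit_prob_cylinder -EFinM; congr (_%:E).
rewrite !big_mkord (bigD1 (Ordinal im)) //= [in RHS](bigD1 (Ordinal im)) //=.
rewrite ci /fix_bit eqxx mul1r; congr (_ * _).
apply: eq_bigr => j /negbTE ji.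
by rewrite (_ : (j : nat) == i = false).
Qed.

Lemma unit_prob_bigsetU_le (I : eqType) (l : seq I) (F : I -> set T) (p : R) :
  (forall i, measurable (F i)) -> (forall i, i \in l -> (P (F i) <= p%:E)%E) ->
  (P (\big[setU/set0]_(i <- l) F i) <= ((size l)%:R * p)%:E)%E.
Proof.
move=> mF; elim: l => [|i l IH] h; first by rewrite big_nil measure0 mul0r.
rewrite big_cons /= -natr1 addrC mulrDl mul1r EFinD.
apply: (le_trans (measureU2 _ _ _)) => //; first by apply: bigsetU_measurable => ? _.
apply: leeD; first by apply: h; rewrite mem_head.
by apply: IH => j jl; apply: h; rewrite inE jl orbT.
Qed.

End fair_bits.

(** * Uniform variables read from disjoint sets of digits *)

Section independent_uniforms.
Set Implicit Arguments.
Unset Strict Implicit.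
Import Order.TTheory GRing.Theory Num.Theory.
Local Open Scope classical_set_scope.
Local Open Scope ring_scope.
Context {R : realType}.
Local Notation T := (measurableTypeR R).
Local Notation P := (@unit_prob R).
Implicit Types (f : nat -> nat) (t : R) (k : nat).

(** The number with binary digits [bit (f 0)], [bit (f 1)], ..., truncated after [k] of them.
    Peeling off the leading digit matches the recursion of [bit_cdf]. *)
Fixpoint bit_sum k f (w : T) : R :=
  if k is k'.+1 then ((bit (f 0%N) w)%:R + bit_sum k' (f \o succn) w) / 2 else 0.

(** The distribution function of such a truncation, conditioned on the leading digit b: (b + S) / 2
    <= t means S <= 2 t - b. *)
Fixpoint bit_cdf k (t : R) : R :=
  if k is k'.+1 then (bit_cdf k' (2 * t) + bit_cdf k' (2 * t - 1)) / 2
  else (0 <= t :> R)%:R.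

Lemma bit_sum_le1 k f w : bit_sum k f w <= 1.
Proof.
elim: k f => //= k IH f; rewrite ler_pdivrMr // mul1r.
by have := IH (f \o succn); case: (bit _ _) => /=; lra.
Qed.

Lemma bit_sum_le_succ k f w : bit_sum k f w <= bit_sum k.+1 f w.
Proof.
elim: k f => [f|k IH f]; first by rewrite /= addr0 divr_ge0.
rewrite [leLHS]/= [leRHS]/= -/(bit_sum k.+1 (f \o succn) w).
by rewrite ler_pM2r ?invr_gt0 // lerD2l; exact: IH.
Qed.

Lemma bit_sum_le_split k f t :
  [set w | bit_sum k.+1 f w <= t] =
  ([set w | bit (f 0%N) w = false] `&` [set w | bit_sum k (f \o succn) w <= 2 * t]) `|`
  ([set w | bit (f 0%N) w = true] `&` [set w | bit_sum k (f \o succn) w <= 2 * t - 1]).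
Proof.
apply/seteqP; split => w /=; rewrite ler_pdivrMr //.
  by case: (bit _ _) => /= h; [right|left]; split => //; lra.
by move=> [] [-> /= h]; lra.
Qed.

Lemma measurable_bit_sum_le k f t : measurable [set w | bit_sum k f w <= t].
Proof.
elim: k f t => [|k IH] f t.
  have [t0|t0] := boolP (0 <= t).
    by rewrite (_ : [set w | _] = setT) //; apply/seteqP.
  by rewrite (_ : [set w | _] = set0) //; apply/seteqP; split => w //; move/negP: t0.
rewrite bit_sum_le_split; apply: measurableU; apply: measurableI => //;
  exact: measurable_bit.
Qed.

Lemma bit_cdf_lt0 k t : t < 0 -> bit_cdf k t = 0.
Proof.
elim: k t => /= [|k IH] t t0; first by rewrite leNgt t0.
by rewrite !IH ?addr0 ?mul0r //; lra.
Qed.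

Lemma bit_cdf_ge1 k t : 1 <= t -> bit_cdf k t = 1.
Proof.
elim: k t => /= [|k IH] t t1; first by rewrite (le_trans ler01 t1).
by rewrite !IH ?divff //; lra.
Qed.

(** One of the two conditional terms is always trivial, equal to 0 or 1, so a single error survives
    at each step and it is halved. *)
Lemma bit_cdf_approx k t : 0 <= t <= 1 -> `|bit_cdf k t - t| <= (2 ^+ k)^-1.
Proof.
elim: k t => [|k IH] t /andP[t0 t1].
  rewrite /= t0 /= expr0 invr1 ler_norml mulr1n; apply/andP; split; lra.
rewrite /= exprS invfM; set e := (_ ^+ k)^-1.
have e0 : 0 <= e by rewrite invr_ge0 exprn_ge0.
have [h|h] := ltP (2 * t) 1.
  rewrite (@bit_cdf_lt0 k (2 * t - 1)); last by lra.
  have /IH : 0 <= 2 * t <= 1 by apply/andP; split; lra.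
  rewrite -/e !ler_norml => /andP[l u]; apply/andP; split; lra.
rewrite (@bit_cdf_ge1 k (2 * t)) //.
have /IH : 0 <= 2 * t - 1 <= 1 by apply/andP; split; lra.
by rewrite -/e !ler_norml => /andP[l u]; apply/andP; split; lra.
Qed.

Lemma cvg_bit_cdf t : 0 <= t <= 1 -> bit_cdf ^~ t @ \oo --> t.
Proof.
move=> /andP[t0 t1]; apply/cvgrPdist_le => e e0.
have : (fun k => (2 ^+ k)^-1 : R) @ \oo --> (0 : R).
  under eq_fun do rewrite -exprVn.
  by apply: cvg_expr; rewrite ger0_norm ?invr_ge0 // invf_lt1 // ltr1n.
move=> /cvgrPdist_le /(_ _ e0); apply: filterS => k.
rewrite sub0r normrN ger0_norm ?invr_ge0 ?exprn_ge0 //; apply: le_trans.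
by rewrite distrC; apply: bit_cdf_approx; rewrite t0.
Qed.

(** Distinct positions inside the window that [c] has not prescribed yet: revealing one of them
    halves the probability of the cylinder. *)
Definition fresh m (c : nat -> option bool) (s : seq nat) :=
  uniq s && all (fun i => (i < m)%N && (c i == None)) s.

Lemma fresh_fix_bit m c i s b : fresh m c (i :: s) ->
  [/\ (i < m)%N, c i = None & fresh m (fix_bit c i b) s].
Proof.
rewrite /fresh /= => /andP[/andP[is_ us] /andP[/andP[im /eqP ci] /allP cs]].
split => //; rewrite us; apply/allP => j js; rewrite /fix_bit.
case: (eqVneq j i) => [ji|_]; last exact: cs.
by move: is_; rewrite -ji js.
Qed.

(** Digits are revealed one at a time, each being recorded in the cylinder, which therefore varies
    in the induction. Once its digits are exhausted, a bit sum is constant and its condition factors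
    out. *)
Lemma unit_prob_bit_sum k0 (l : seq ((nat -> nat) * R)) c m :
  fresh m c (flatten [seq mkseq p.1 k0 | p <- l]) ->
  P (cylinder c 0 m `&` [set w | all (fun p => bit_sum k0 p.1 w <= p.2) l]) =
  (P (cylinder c 0 m) * (\prod_(p <- l) bit_cdf k0 p.2)%:E)%E.
Proof.
elim: l c => [|[f t] l IHl] c.
  move=> _; rewrite big_nil mule1; congr (P _).
  by apply/seteqP; split => w // [].
rewrite [flatten _]/= big_cons [_.2]/=.
set J := [set w | all (fun p => bit_sum k0 p.1 w <= p.2) l].
rewrite (_ : [set w | _] = [set w | bit_sum k0 f w <= t] `&` J); last first.
  by apply/seteqP; split => w /=; [move=> /andP[]|move=> [-> ]].
have mJ : measurable J.
  rewrite (_ : J = \big[setI/setT]_(p <- l) [set w | bit_sum k0 p.1 w <= p.2]).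
    by apply: bigsetI_measurable => p _; exact: measurable_bit_sum_le.
  rewrite /J; elim: (l) => [|p l' IH']; first by rewrite big_nil; apply/seteqP; split.
  rewrite big_cons -IH'.
  by apply/seteqP; split => w /=; [move=> /andP[]|move=> [-> ]].
move: IHl; set L := flatten _ => IHl.
(* Inner induction on the digits of the first sequence; its threshold moves with the revealed
   digits, while the sequences in [l] keep all their [k0] digits. *)
have step : forall k f t c, fresh m c (mkseq f k ++ L) ->
    P (cylinder c 0 m `&` ([set w | bit_sum k f w <= t] `&` J)) =
    (P (cylinder c 0 m) * (bit_cdf k t * \prod_(p <- l) bit_cdf k0 p.2)%:E)%E.
  elim=> [|k IH] g s d; first rewrite cat0s => fr.
    have [s0|s0] := boolP (0 <= s).
      rewrite (_ : [set w | _] = setT); last by apply/seteqP; split.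
      by rewrite setTI IHl //= s0 mul1r.
    rewrite (_ : [set w | _] = set0); last first.
      by apply/seteqP; split => w //=; move/negP: s0.
    by rewrite set0I setI0 measure0 /= (negbTE s0) mul0r mule0.
  rewrite (_ : mkseq g k.+1 = g 0%N :: mkseq (g \o succn) k); last first.
    by rewrite /mkseq /= -[in LHS]addn1 addnC iotaDl -map_comp.
  move=> fr.
  have [gm dg _] := fresh_fix_bit true fr.
  have part b s' : P (cylinder d 0 m `&` [set w | bit (g 0%N) w = b] `&`
       ([set w | bit_sum k (g \o succn) w <= s'] `&` J)) =
     (P (cylinder d 0 m) * (2^-1 * (bit_cdf k s' * \prod_(p <- l) bit_cdf k0 p.2))%:E)%E.
    have [_ _ fr'] := fresh_fix_bit b fr.
    rewrite -cylinder_fix_bit // IH // unit_prob_fix_bit //.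
    by rewrite [(2^-1%:E * _)%E]muleC -muleA -EFinM.
  have mA : measurable (cylinder d 0 m `&` ([set w | bit_sum k.+1 g w <= s] `&` J)).
    apply: measurableI; first exact: measurable_cylinder.
    by apply: measurableI => //; exact: measurable_bit_sum_le.
  rewrite (unit_prob_bit_split (g 0%N) mA).
  rewrite (_ : _ `&` [set w | bit (g 0%N) w = false] =
    cylinder d 0 m `&` [set w | bit (g 0%N) w = false] `&`
       ([set w | bit_sum k (g \o succn) w <= 2 * s] `&` J)); last first.
    rewrite bit_sum_le_split; apply/seteqP; split => w /=.
      by move=> [[? [[[]|[-> ?]] ?]]].
    by move=> [[? ?] [? ?]]; do ![split => //]; left.
  rewrite (_ : _ `&` [set w | bit (g 0%N) w = true] =
    cylinder d 0 m `&` [set w | bit (g 0%N) w = true] `&`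
       ([set w | bit_sum k (g \o succn) w <= 2 * s - 1] `&` J)); last first.
    rewrite bit_sum_le_split; apply/seteqP; split => w /=.
      by move=> [[? [[[-> ?]|[]] ?]]].
    by move=> [[? ?] [? ?]]; do ![split => //]; right.
  rewrite !part !unit_prob_cylinder -!EFinM -EFinD /=; congr (_%:E).
  by field.
exact: step.
Qed.

(** The truncations increase, so this is their limit; as a supremum it turns [unif f w <= t] into an
    exact countable conjunction. *)
Definition unif f (w : T) : R := sup (range (fun k => bit_sum k f w)).

Lemma unif_le f w t : unif f w <= t <-> forall k, bit_sum k f w <= t.
Proof.
have ub : has_ubound (range (fun k => bit_sum k f w)).
  by exists 1 => _ [k _ <-]; exact: bit_sum_le1.
split=> [le_t k|le_t].
  by apply: le_trans le_t; apply: ub_le_sup => //; exists k.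
by apply: ge_sup; [exists (bit_sum 0 f w), 0%N|move=> _ [k _ <-]].
Qed.

Lemma unif_le1 f w : unif f w <= 1.
Proof. by apply/unif_le => k; exact: bit_sum_le1. Qed.

(** Injectivity of [pickle] makes distinct edges read disjoint sets of digits, which is the source
    of independence. *)
Definition edge_bits (e : nat * nat) k : nat := pickle (e, k).

(** The product formula is exact for truncations to k digits. The corresponding events decrease with
    k, so both sides pass to the limit. *)
Lemma unit_prob_unif (s : seq (nat * nat)) (t : nat * nat -> R) :
  uniq s -> (forall e, 0 <= t e <= 1) ->
  P [set w | all (fun e => unif (edge_bits e) w <= t e) s] = (\prod_(e <- s) t e)%:E.
Proof.
move=> us t01.
pose A k := [set w : T | all (fun e => bit_sum k (edge_bits e) w <= t e) s].
have mA k : measurable (A k).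
  rewrite (_ : A k = \big[setI/setT]_(e <- s) [set w | bit_sum k (edge_bits e) w <= t e]).
    by apply: bigsetI_measurable => e _; exact: measurable_bit_sum_le.
  rewrite /A; elim: (s) => [|e s' IH']; first by rewrite big_nil; apply/seteqP; split.
  rewrite big_cons -IH'.
  by apply/seteqP; split => w /=; [move=> /andP[]|move=> [-> ]].
rewrite (_ : [set w | _] = \bigcap_k A k); last first.
  apply/seteqP; split => w /=.
    move=> /allP h k _; apply/allP => e es.
    by move: (h e es) => /unif_le.
  move=> h; apply/allP => e es; apply/unif_le => k.
  by have /allP := h k I; apply.
have PA k : P (A k) = (\prod_(e <- s) bit_cdf k (t e))%:E.
  pose l := [seq (edge_bits e, t e) | e <- s].
  pose I := flatten [seq mkseq p.1 k | p <- l].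
  (* Nothing is prescribed at the start, so the cylinder is the whole space; the window ends just
     after the largest position read. *)
  have := @unit_prob_bit_sum k l (fun=> None) (\max_(i <- I) i).+1.
  rewrite big_map (_ : [set w | all _ l] = A k); last first.
    by apply/seteqP; split => w; rewrite /A /= all_map.
  rewrite (_ : cylinder _ _ _ = setT); last by apply/seteqP; split.
  rewrite setTI probability_setT mul1e; apply.
  rewrite /fresh; apply/andP; split; last first.
    by apply/allP => i iI; rewrite ltnS eqxx andbT (leq_bigmax_seq (F := id)).
  rewrite /I /l -map_comp.
  rewrite (_ : flatten _ = [seq edge_bits e j | e <- s, j <- iota 0 k]) //.
  apply: allpairs_uniq => //; first exact: iota_uniq.
  by move=> [e j] [e' j'] _ _ /= /(pcan_inj pickleK) [-> ->].
have cvA : (P \o A) @ \oo --> P (\bigcap_k A k).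
  apply: nonincreasing_cvg_mu => //.
  - by rewrite (le_lt_trans (probability_le1 _ _)) ?ltry.
  - exact: bigcap_measurableType.
  - apply/nonincreasing_seqP => k; apply/subsetPset => w /allP h.
    by apply/allP => e es; apply: le_trans (h e es); exact: bit_sum_le_succ.
have cvB : (P \o A) @ \oo --> (\prod_(e <- s) t e)%:E.
  rewrite (_ : P \o A = EFin \o fun k => \prod_(e <- s) bit_cdf k (t e)); last first.
    by apply/funext => k /=; exact: PA.
  apply: cvg_EFin; first exact: nearW.
  elim: (s) => [|e s' IH'].
    by rewrite big_nil; under eq_fun do rewrite big_nil; exact: cvg_cst.
  rewrite big_cons; under eq_fun do rewrite big_cons.
  by apply: cvgM => //; exact: cvg_bit_cdf.
exact: cvg_unique cvA cvB.
Qed.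

End independent_uniforms.

(** * Quantile coupling *)

Section quantile_coupling.
Set Implicit Arguments.
Unset Strict Implicit.
Import Order.TTheory GRing.Theory Num.Theory.
Local Open Scope classical_set_scope.
Local Open Scope ring_scope.
Local Open Scope ereal_scope.
Context {R : realType}.
Local Notation T := (measurableTypeR R).
Local Notation P := (@unit_prob R).
Implicit Types (nu : probability (\bar R) R) (s : \bar R) (u : R).

Definition low_ray s : set (\bar R) := [set x | x <= s].

Lemma measurable_low_ray s : measurable (low_ray s).
Proof.
by rewrite (_ : low_ray s = [set x : \bar R | id x <= s]) // -[X in measurable X]setTI;
   exact: emeasurable_fun_infty_c.
Qed.

(** Prepares the right continuity of the distribution function, also at -oo, which may be an atom
    and is approached along -n. *)
Lemma low_ray_bigcap s : s != +oo -> exists t : nat -> \bar R,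
  [/\ forall n, s < t n, {homo t : m n / (m <= n)%N >-> n <= m} &
      low_ray s = \bigcap_n low_ray (t n)].
Proof.
case: s => [r| |] // _.
  exists (fun n => (r + n.+1%:R^-1)%:E); split.
  - by move=> n; rewrite lte_fin ltrDl invr_gt0.
  - by move=> m n mn; rewrite lee_fin lerD2l lef_pV2 ?posrE // ler_nat.
  - apply/seteqP; split => x /=.
      move=> xr n _ /=; apply: le_trans xr _.
      by rewrite lee_fin lerDl invr_ge0.
    move=> xr; apply/lee_addgt0Pr => e e0.
    have [n ne] : exists n, (n.+1%:R^-1 < e :> R)%R.
      by near \oo => n; exists n; near: n; exact: near_infty_natSinv_lt (PosNum e0).
    apply: le_trans (xr n I) _.
    by rewrite -EFinD lee_fin lerD2l ltW.
exists (fun n => (- n%:R)%:E); split.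
- by move=> n; rewrite ltNyr.
- by move=> m n mn; rewrite lee_fin lerN2 ler_nat.
- apply/seteqP; split => x /=.
    by rewrite /low_ray /= leeNy_eq => /eqP -> n _; rewrite /= leNye.
  move=> xr; rewrite /low_ray /= leNgt; apply/negP; case: x xr => [x| |] // xr _.
    have := xr (Num.truncn `|x|%R).+1 I.
    rewrite /low_ray /= lee_fin lerNr => h.
    have := truncnS_gt `|x|%R; rewrite ltNge (le_trans h) //.
    by rewrite -normrN ler_norm.
  by have := xr 0%N I.
Unshelve. all: by end_near. Qed.

Definition quantile nu u : \bar R := ereal_inf [set s | u%:E <= nu (low_ray s)].

Lemma le_low_ray nu s t : s <= t -> nu (low_ray s) <= nu (low_ray t).
Proof.
move=> st; apply: le_measure; rewrite ?inE; try exact: measurable_low_ray.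
by move=> x /= /le_trans; apply.
Qed.

(** A Galois connection: right continuity makes the infimum attained, and [u <= 1] settles the case
    [s = +oo]. *)
Lemma quantile_le nu u s : (u <= 1)%R ->
  quantile nu u <= s <-> u%:E <= nu (low_ray s).
Proof.
move=> u1; split; last by move=> us; apply: ereal_inf_lbound.
have [->|sy] := eqVneq s +oo.
  move=> _; rewrite (_ : low_ray _ = setT) ?probability_setT ?lee_fin //.
  by apply/seteqP; split => x //= _; exact: leey.
move=> qs; have [t [st tn E]] := low_ray_bigcap sy.
have cv : (nu \o (fun n => low_ray (t n))) @ \oo --> nu (low_ray s).
  rewrite E; apply: nonincreasing_cvg_mu.
  - by rewrite (le_lt_trans (probability_le1 _ _)) ?ltry //; exact: measurable_low_ray.
  - by move=> n; exact: measurable_low_ray.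
  - by rewrite -E; exact: measurable_low_ray.
  - by move=> m n mn; apply/subsetPset => x /= /le_trans; apply; exact: tn.
rewrite -(cvg_lim _ cv) //; apply: lime_ge; first exact: cvgP cv.
apply: nearW => n /=.
have /ereal_inf_lt [s' us' s't] := le_lt_trans qs (st n).
exact: le_trans us' (le_low_ray nu (ltW s't)).
Qed.

(* All laws read the same uniform variables, which couples them monotonically. *)
Definition sample nu (i j : nat) (w : T) : \bar R :=
  quantile nu (unif (edge_bits (i, j)) w).

Lemma sample_le nu i j s w : sample nu i j w <= s <->
  (unif (edge_bits (i, j)) w <= fine (nu (low_ray s)))%R.
Proof.
rewrite quantile_le ?unif_le1 // -lee_fin fineK //.
by apply: fin_num_measure; exact: measurable_low_ray.
Qed.

Lemma measurable_sample_le nu i j s : measurable [set w | sample nu i j w <= s].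
Proof.
rewrite (_ : [set w | _] = \bigcap_k [set w |
    (bit_sum k (edge_bits (i, j)) w <= fine (nu (low_ray s)))%R]).
  by apply: bigcapT_measurable => k; exact: measurable_bit_sum_le.
apply/seteqP; split => w /=.
  by move=> /sample_le /unif_le h k _; exact: h.
by move=> h; apply/sample_le/unif_le => k; exact: h.
Qed.

Lemma measurable_sample nu i j : measurable_fun setT (sample nu i j).
Proof.
apply: (measurability _ (ErealGenOInfty.measurableE R)) => _ [_ [r ->] <-].
rewrite setTI (_ : _ @^-1` _ = ~` [set w | sample nu i j w <= r%:E]).
  by apply: measurableC; exact: measurable_sample_le.
by apply/seteqP; split => w /=; rewrite in_itv /= andbT ltNge => /negP.
Qed.

HB.instance Definition _ nu i j :=
  isMeasurableFun.Build _ _ _ _ (sample nu i j) (measurable_sample nu i j).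

Lemma low_ray_generates : 'measurable = <<s range low_ray >> :> set (set (\bar R)).
Proof.
apply/seteqP; split; last first.
  by apply: smallest_sub; [exact: sigma_algebra_measurable|move=> _ [s _ <-]; exact: measurable_low_ray].
rewrite [X in X `<=` _](ErealGenOInfty.measurableE R).
apply: smallest_sub; first exact: smallest_sigma_algebra.
move=> _ [r ->]; rewrite (_ : [set` _] = ~` low_ray r%:E).
  rewrite -setTD; apply: sigma_algebraCD.
  by apply: sub_sigma_algebra; exists r%:E.
by apply/seteqP; split => x /=; rewrite in_itv /= andbT ltNge => /negP.
Qed.

(** Both sides are finite measures of [A], and low rays form a generating class that is stable under
    intersection and contains the whole space. *)
Lemma independent_low_ray_ext nu (D : set T) (X : {RV P >-> \bar R}) : measurable D ->
  (forall s, P (D `&` X @^-1` low_ray s) = P D * nu (low_ray s)) ->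
  forall A, measurable A -> P (D `&` X @^-1` A) = P D * nu A.
Proof.
move=> mD h A mA.
have PD : P D \is a fin_num by exact: fin_num_measure.
pose c := NngNum (fine_ge0 (measure_ge0 P D)).
pose m1 := pushforward (mrestr P mD) X.
pose m2 := mscale c nu.
have E1 B : m1 B = P (D `&` X @^-1` B) by rewrite /m1 /pushforward /mrestr setIC.
have E2 B : m2 B = P D * nu B by rewrite /m2 /mscale /= fineK.
rewrite -E1 -E2.
apply: (measure_unique (range low_ray) (fun=> setT)) => //.
- exact: low_ray_generates.
- move=> _ _ [s _ <-] [t _ <-]; exists (Order.min s t) => //.
  by apply/seteqP; split => x /=; rewrite /low_ray /= le_min => /andP.
- move=> _; exists +oo => //; apply/seteqP; split => x //= _; exact: leey.
- by rewrite bigcup_const.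
- by move=> _ [s _ <-]; exact: etrans (E1 _) (etrans (h s) (esym (E2 _))).
- move=> _; apply: (@le_lt_trans _ _ 1); last exact: ltry.
  by rewrite [leLHS]E1; apply: probability_le1; apply: measurableI => //; rewrite preimage_setT.
Qed.

Lemma unit_prob_sample_low_rays nu (l : seq (nat * nat)) (t : nat * nat -> \bar R) :
  uniq l -> P (\big[setI/setT]_(e <- l) (sample nu e.1 e.2 @^-1` low_ray (t e))) =
  \prod_(e <- l) nu (low_ray (t e)).
Proof.
move=> ul; have := @unit_prob_unif R l (fun e => fine (nu (low_ray (t e)))) ul.
have -> : [set w | all (fun e => (unif (edge_bits e) w <= fine (nu (low_ray (t e))))%R) l] =
    \big[setI/setT]_(e <- l) (sample nu e.1 e.2 @^-1` low_ray (t e)).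
  elim: (l) => [|e l' IH]; first by rewrite big_nil; apply/seteqP; split.
  rewrite big_cons -IH; apply/seteqP; split => w /=.
    by move=> /andP[h ->]; split => //; apply/sample_le; case: (e) h.
  by move=> [/sample_le h ->]; rewrite andbT; case: (e) h.
move=> ->; last first.
  move=> e; rewrite fine_ge0 ?measure_ge0 //= -lee_fin fineK; last first.
    by apply: fin_num_measure; exact: measurable_low_ray.
  by apply: probability_le1; exact: measurable_low_ray.
elim: (l) => [|e l' IH]; first by rewrite !big_nil.
rewrite !big_cons EFinM IH fineK //.
by apply: fin_num_measure; exact: measurable_low_ray.
Qed.

(** A mixed statement for the induction: the edges of [l1] already carry arbitrary sets, those of
    [l2] still carry low rays, and edges are upgraded one by one with [independent_low_ray_ext]. *)
Lemma unit_prob_sample nu (l1 l2 : seq (nat * nat)) A (t : nat * nat -> \bar R) :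
  (forall e, measurable (A e)) -> uniq (l1 ++ l2) ->
  P (\big[setI/setT]_(e <- l1) (sample nu e.1 e.2 @^-1` A e) `&`
     \big[setI/setT]_(e <- l2) (sample nu e.1 e.2 @^-1` low_ray (t e))) =
  \prod_(e <- l1) nu (A e) * \prod_(e <- l2) nu (low_ray (t e)).
Proof.
move=> mA; elim: l1 l2 t => [|e l1 IH] l2 t.
  by rewrite /= => ul; rewrite !big_nil setTI mul1e unit_prob_sample_low_rays.
rewrite /= => /andP[el1 ul]; rewrite !big_cons -setIA [X in P X]setIC -muleA [RHS]muleC.
have mpre i j B : measurable B -> measurable (sample nu i j @^-1` B).
  by move=> mB; rewrite -[X in measurable X]setTI; exact: measurable_sample.
rewrite (@independent_low_ray_ext nu _ (sample nu e.1 e.2 : {RV P >-> \bar R})) ?IH //.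
  apply: measurableI; apply: bigsetI_measurable => f _; apply: mpre => //.
  exact: measurable_low_ray.
move=> s; pose t' f := if f == e then s else t f.
have := IH (e :: l2) t'; rewrite !big_cons /t' eqxx -/t'.
have e2 (f : nat * nat) : f \in l2 -> t' f = t f.
  move=> fl; rewrite /t'; case: eqP => // fe.
  by move: el1; rewrite mem_cat -fe fl orbT.
have -> : \big[setI/setT]_(f <- l2) (sample nu f.1 f.2 @^-1` low_ray (t' f)) =
    \big[setI/setT]_(f <- l2) (sample nu f.1 f.2 @^-1` low_ray (t f)).
  by apply: eq_big_seq => f fl; rewrite e2.
have -> : \prod_(f <- l2) nu (low_ray (t' f)) = \prod_(f <- l2) nu (low_ray (t f)).
  by apply: eq_big_seq => f fl; rewrite e2.
move=> h; rewrite -setIA [X in _ `&` X]setIC h; last first.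
  by rewrite -cat1s uniq_catCA /= el1.
by rewrite [nu (low_ray s) * _]muleC muleA.
Qed.

Lemma unit_prob_sample1 nu i j A : measurable A -> P (sample nu i j @^-1` A) = nu A.
Proof.
move=> mA; have := @unit_prob_sample nu [:: (i, j)] [::] (fun=> A) (fun=> +oo).
by rewrite !big_cons !big_nil !setIT !mule1; apply.
Qed.

Lemma iid_sample nu : iid_weights nu (fun i j => sample nu i j : {RV P >-> \bar R}).
Proof.
split=> [i j _ A mA|l A ul _ mA]; first exact: unit_prob_sample1.
have := @unit_prob_sample nu l [::] A (fun=> +oo) mA.
rewrite cats0 big_nil setIT big_nil mule1 => -> //.
by apply: eq_bigr => e _; rewrite unit_prob_sample1.
Qed.

End quantile_coupling.

(** * Levy-Prokhorov closeness of coupled weights *)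

Section levy_prokhorov_coupling.
Set Implicit Arguments.
Unset Strict Implicit.
Import Order.TTheory GRing.Theory Num.Theory.
Local Open Scope classical_set_scope.
Local Open Scope ring_scope.
Local Open Scope ereal_scope.
Context {R : realType}.
Local Notation T := (measurableTypeR R).
Local Notation P := (@unit_prob R).
Implicit Types (nu : probability (\bar R) R) (s : \bar R) (rho : \bar R -> \bar R -> R).

Definition high_ray s : set (\bar R) := [set x | s <= x].

Lemma measurable_high_ray s : measurable (high_ray s).
Proof.
by rewrite (_ : high_ray s = [set x : \bar R | s <= id x]) // -[X in measurable X]setTI;
   exact: emeasurable_fun_c_infty.
Qed.

Lemma measurable_high_ray_lty s : measurable [set x | s <= x < +oo].
Proof.
rewrite (_ : [set x | _] = high_ray s `\` [set +oo]).
  by apply: measurableD; [exact: measurable_high_ray|exact: emeasurable_set1].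
apply/seteqP; split => x /=; rewrite /high_ray /=.
  by move=> /andP[-> /lt_eqF /negbT /eqP].
by move=> [-> /eqP xy]; rewrite ltey.
Qed.

(** The space without +oo is open in the extended line, so neighbourhoods in the subspace are
    neighbourhoods in the whole line. *)
Lemma compatible_metric_nbhs rho x V : compatible_metric rho -> x != +oo ->
  nbhs x V <-> exists2 e : R, (0 < e)%R & forall y, y != +oo -> (rho x y < e)%R -> V y.
Proof.
move=> [_ _ _ top] xy; have lx : lowR x by move=> /eqP; rewrite (negbTE xy).
split.
  move=> xV; have /(top x V lx) [e e0 h] : within (@lowR R) (nbhs x) V.
    by apply: filterS xV => y Vy _.
  by exists e => // y /eqP yy; exact: h.
move=> [e e0 h]; have /(top x V lx) : exists2 e : R, (0 < e)%R &
    forall y, lowR y -> (rho x y < e)%R -> V y.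
  by exists e => // y ly; apply: h; apply/eqP.
rewrite /within /= => w.
have : nbhs x (@lowR R).
  apply: open_nbhs_nbhs; split => //.
  rewrite (_ : @lowR R = [set y | y < +oo]); first exact: open_ereal_lt_ereal.
  by apply/seteqP; split => y /=; rewrite /lowR /= ltey => /eqP.
by apply: filterS2 w => y; apply.
Qed.

Lemma open_emeasurable (U : set (\bar R)) : open U -> measurable U.
Proof.
move=> oU; rewrite (_ : U = [set x%:E | x in EFin @^-1` U] `|`
    (U `&` [set -oo]) `|` (U `&` [set +oo])); last first.
  apply/seteqP; split => [[x| |]|x] /=.
  - by move=> Ux; left; left; exists x.
  - by move=> Ux; right.
  - by move=> Ux; left; right.
  - by move=> [[[r Ur <-]|[]]|[]].
have m1 x : measurable (U `&` [set x]).
  have [Ux|Ux] := pselect (U x).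
    rewrite (_ : _ `&` _ = [set x]); first exact: emeasurable_set1.
    by apply/seteqP; split => [y []|y ->].
  by rewrite (_ : _ `&` _ = set0) //; apply/seteqP; split => // y [] /[swap] ->.
apply: measurableU => //; apply: measurableU => //.
apply: measurable_image_EFin; apply: open_measurable.
by rewrite openE => r Ur; have := oU; rewrite openE => /(_ _ Ur).
Qed.

Lemma measurable_thickening rho e A : compatible_metric rho -> A `<=` @lowR R ->
  measurable (thickening rho e A).
Proof.
move=> hrho Al; apply: open_emeasurable; rewrite openE => y [ly [x Ax xy]].
have y1 : y != +oo by apply/eqP.
apply/(compatible_metric_nbhs _ hrho y1); exists (e - rho x y)%R; first by rewrite subr_gt0.
move=> z /eqP zl yz; split => //; exists x => //.
have [_ _ tri _] := hrho.
by apply: le_lt_trans (tri x y z _ _ _) _; rewrite ?inE //; [exact: Al|lra].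
Qed.

(** Half of the portmanteau theorem, for one closed set: its thickenings decrease to it, so a small
    one adds at most [eta / 2] of mass, and [delta] bounds both the radius and the additive
    error. *)
Lemma levy_prokhorov_closed rho nu F : compatible_metric rho -> M1 nu -> closed F ->
  forall eta : R, (0 < eta)%R -> exists2 delta : R, (0 < delta)%R &
  forall nu' : probability (\bar R) R, M1 nu' -> (levy_prokhorov rho nu nu' < delta)%R ->
    nu' F <= nu F + eta%:E.
Proof.
move=> hrho nu1 cF eta eta0.
have [rho0 rhoC tri _] := hrho.
have mF : measurable F.
  by rewrite -[F]setCK; apply: measurableC; apply: open_emeasurable; rewrite openC.
have mlow : measurable (@lowR R) by apply: measurableC; exact: emeasurable_set1.
(* The metric is constrained only away from +oo, a point that laws in [M1] do not charge. *)
pose A := F `&` @lowR R.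
have mA : measurable A by exact: measurableI.
have Al : A `<=` @lowR R by move=> x [].
have mth e := measurable_thickening e hrho Al.
pose th n := thickening rho n.+1%:R^-1 A.
have thE : \bigcap_n th n = A.
  apply/seteqP; split => [y h|y Ay n _]; last first.
    split; first exact: Al; exists y => //.
    rewrite (_ : rho y y = 0%R) ?invr_gt0 //; apply/rho0; rewrite ?inE //; exact: Al.
  have [ly _] := h 0%N I; split => //; apply: contrapT => Fy.
  have yy : y != +oo by apply/eqP.
  have : nbhs y (~` F) by apply: open_nbhs_nbhs; split => //; rewrite openC.
  move=> /(compatible_metric_nbhs _ hrho yy) [e e0 he].
  have [n ne] : exists n, (n.+1%:R^-1 < e :> R)%R.
    by near \oo => n; exists n; near: n; exact: near_infty_natSinv_lt (PosNum e0).
  have [_ [x [Fx lx] xy]] := h n I.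
  apply: (he x _ _ Fx); first exact/eqP.
  by rewrite rhoC ?inE //; exact: lt_trans xy ne.
have cv : (nu \o th) @ \oo --> nu A.
  rewrite -thE; apply: nonincreasing_cvg_mu => //.
  - by rewrite (le_lt_trans (probability_le1 _ _)) ?ltry //; exact: mth.
  - by move=> n; exact: mth.
  - by rewrite thE.
  - move=> m n mn; apply/subsetPset => y [ly [x Ax xy]]; split => //; exists x => //.
    by apply: lt_le_trans xy _; rewrite lef_pV2 ?posrE // ler_nat.
have nuA : nu A \is a fin_num by exact: fin_num_measure.
have [n hn] : exists n, nu (th n) <= nu A + (eta / 2)%:E.
  have : nu A < nu A + (eta / 2)%:E by rewrite lteDl // lte_fin divr_gt0.
  move=> lt; have : nbhs (nu A) [set y | y < nu A + (eta / 2)%:E].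
    by apply: open_nbhs_nbhs; split => //; exact: open_ereal_lt_ereal.
  by move=> /cv [n _ /(_ n (leqnn n)) /ltW]; exists n.
exists (Order.min n.+1%:R^-1 (eta / 2))%R.
  by rewrite lt_min invr_gt0 ltr0n divr_gt0.
move=> nu' nu'1; rewrite /levy_prokhorov => /inf_lt [].
  (* The infimum is over a nonempty set: 1 is admissible because probabilities are at most 1. *)
  exists 1%R; split => // B mB Bl.
  by split; (apply: (@le_trans _ _ 1); [exact: probability_le1|]);
    rewrite -[leLHS]add0e leeD2r.
move=> e [e0 he]; rewrite lt_min => /andP[en e2].
have [_ hA] := he A mA Al.
have FA (m : probability (\bar R) R) : M1 m -> m F = m A.
  move=> m1; rewrite (measureDI m mF mlow) -[RHS]add0e; congr (_ + _).
  apply: (@subset_measure0 _ _ _ m _ [set +oo]) => //.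
  - exact: measurableD.
  - by move=> x [_ /contrapT].
rewrite !FA //; apply: le_trans hA _.
apply: (@le_trans _ _ (nu (th n) + (eta / 2)%:E)).
  apply: leeD; last by rewrite lee_fin ltW.
  apply: le_measure; rewrite ?inE //; try exact: mth.
  by move=> y [ly [x Ax xy]]; split => //; exists x => //; apply: lt_trans xy en.
apply: le_trans (leeD2r _ hn) _.
by rewrite -addeA -EFinD -splitr.
Unshelve. all: by end_near. Qed.

(** The benefit of a monotone coupling: between nested events, an inequality of probabilities bounds
    the probability of the difference. *)
Lemma nested_setD_le d (Om : measurableType d) (m : probability Om R) (D D' : set Om)
    (eta : R) : measurable D -> measurable D' -> D `<=` D' \/ D' `<=` D ->
  (0 <= eta)%R -> m D' <= m D + eta%:E -> m (D' `\` D) <= eta%:E.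
Proof.
move=> mD mD' [DD'|D'D] eta0 h; last first.
  by rewrite (_ : D' `\` D = set0) ?measure0 ?lee_fin // setD_eq0.
rewrite measureD //; last by rewrite (le_lt_trans (probability_le1 _ _)) ?ltry.
by rewrite (setIidr DD') leeBlDl //; exact: fin_num_measure.
Qed.

Lemma quantile_mono nu (u v : R) : (u <= v)%R -> quantile nu u <= quantile nu v.
Proof.
move=> uv; apply: le_ereal_inf => s /=; apply: le_trans.
by rewrite lee_fin.
Qed.

(** Both events are conditions of the form that one common uniform variable is small, so one implies
    the other. *)
Lemma sample_low_ray_nested nu nu' i j s :
  let D := sample nu i j @^-1` low_ray s in
  let D' := sample nu' i j @^-1` low_ray s in D `<=` D' \/ D' `<=` D.
Proof.
move=> D D'; have [h|/existsNP [w /not_implyP [Dw nDw]]] := pselect (D `<=` D'); first by left.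
right => v D'v; rewrite /D /= /low_ray /=; apply: le_trans Dw.
rewrite /sample; apply: quantile_mono; rewrite leNgt; apply/negP => lt.
apply: nDw; apply: le_trans D'v; apply: quantile_mono; exact: ltW.
Qed.

Lemma sample_high_ray_nested nu nu' i j s :
  let D := sample nu i j @^-1` high_ray s in
  let D' := sample nu' i j @^-1` high_ray s in D `<=` D' \/ D' `<=` D.
Proof.
move=> D D'; have [h|/existsNP [w /not_implyP [Dw nDw]]] := pselect (D `<=` D'); first by left.
right => v D'v; rewrite /D /= /high_ray /=; apply: le_trans Dw _.
rewrite /sample; apply: quantile_mono; rewrite leNgt; apply/negP => lt.
apply: nDw; apply: le_trans D'v _; apply: quantile_mono; exact: ltW.
Qed.

Lemma measurable_sample_preimage nu i j A : measurable A ->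
  measurable (sample nu i j @^-1` A).
Proof. by move=> mA; rewrite -[X in measurable X]setTI; exact: measurable_sample. Qed.

(* a and a' are compared with the points of a grid of mesh eps on [-(K + 1), B];
   starting below -K leaves room for one cell of error. *)
Lemma grid_close (B K eps : R) m (a a' : \bar R) : (0 < eps <= 1)%R ->
  (B + K + 1 <= m%:R * eps)%R -> a <= B%:E -> a' <= B%:E ->
  (forall k, (k <= m)%N -> a' <= (- (K + 1) + k%:R * eps)%:E ->
     a <= (- (K + 1) + k%:R * eps)%:E) ->
  (forall k, (k <= m)%N -> (- (K + 1) + k%:R * eps)%:E <= a' ->
     (- (K + 1) + k%:R * eps)%:E <= a) ->
  ((- K)%:E <= a -> a <= a' + (2 * eps)%:E) /\
  ((- K)%:E <= a' -> a' <= a + (2 * eps)%:E).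
Proof.
move=> /andP[e0 e1] mB aB a'B lo hi.
have grid (r : R) : (- K <= r)%R -> (r <= B)%R -> exists k, [/\ (0 < k)%N, (k <= m)%N,
    (- (K + 1) + k%:R * eps <= r)%R & (r < - (K + 1) + k%:R * eps + eps)%R].
  move=> Kr rB; pose z := ((r + K + 1) / eps)%R.
  have z1 : (1 <= z)%R by rewrite ler_pdivlMr // mul1r; lra.
  have zE : (z * eps = r + K + 1)%R by rewrite /z -mulrA mulVf ?mulr1 // gt_eqF.
  have := Num.Theory.truncn_itv (le_trans ler01 z1).
  set k := Num.truncn z => /andP[k1 k2]; exists k; split.
  - by rewrite /k Num.Theory.truncn_gt0.
  - rewrite -(ler_nat R); apply: le_trans k1 _.
    by rewrite /z ler_pdivrMr //; lra.
  - have : (k%:R * eps <= z * eps)%R by rewrite ler_pM2r.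
    by rewrite zE; lra.
  - have : (z * eps < k.+1%:R * eps)%R by rewrite ltr_pM2r.
    by rewrite zE -natr1; lra.
split.
- case: a aB lo hi => // r; rewrite !lee_fin => rB lo _ Kr.
  have [k [k0 km k1 k2]] := grid r Kr rB.
  rewrite leNgt; apply/negP => lt.
  (* If [a'] is more than [2 * eps] below [r], it lies below the grid point of index [k.-1]; then so
     does [a], although [r] is above the next point. *)
  have h := lo k.-1 (leq_trans (leq_pred _) km).
  have kE : (k%:R = k.-1%:R + 1 :> R)%R by rewrite natr1 prednK.
  rewrite kE in k1 k2.
  clear lo a'B; case: a' lt h => [r'| |] //=; rewrite ?lte_fin ?lee_fin => lt h.
    suff : (r <= - (K + 1) + k.-1%:R * eps)%R by lra.
    by apply: h; lra.
  suff : (r <= - (K + 1) + k.-1%:R * eps)%R by lra.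
  by apply: h; exact: leNye.
- case: a' a'B lo hi => // r; rewrite !lee_fin => rB _ hi Kr.
  have [k [k0 km k1 k2]] := grid r Kr rB.
  have := hi k km; rewrite lee_fin => /(_ k1); clear hi aB.
  case: a => [r'| |] //; rewrite ?lee_fin -?EFinD ?lee_fin => h.
    by lra.
  by rewrite addye // leey.
Qed.

Lemma esssup_high_ray0 nu (t : R) : M1 nu -> esssup nu < t%:E -> nu (high_ray t%:E) = 0.
Proof.
move=> nu1 /ereal_inf_lt [_ [r r0 <-]]; rewrite lte_fin => rt.
have mr := measurable_high_ray r%:E.
have my := emeasurable_set1 (@EPInf R).
have mry := measurable_high_ray_lty r%:E.
have null : nu ([set x | r%:E <= x < +oo] `|` [set +oo]) = 0.
  exact: null_set_setU.
apply: (@subset_measure0 _ _ _ nu _ ([set x | r%:E <= x < +oo] `|` [set +oo])).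
- exact: measurable_high_ray.
- exact: measurableU.
- move=> x; rewrite /high_ray /= => tx; have [->|xy] := eqVneq x +oo; first by right.
  by left; rewrite ltey xy andbT; apply: le_trans tx; rewrite lee_fin ltW.
- exact: null.
Qed.

Lemma esssup_high_ray_gt0 nu (t : R) : t%:E < esssup nu -> 0 < nu (high_ray t%:E).
Proof.
move=> lt; rewrite lt0e measure_ge0 andbT; apply/eqP => h0.
suff : esssup nu <= t%:E by rewrite leNgt lt.
apply: ereal_inf_lbound; exists t => //.
apply: (@subset_measure0 _ _ _ nu _ (high_ray t%:E)) => //.
- exact: measurable_high_ray_lty.
- exact: measurable_high_ray.
- by move=> x /= /andP[].
Qed.

(** The bound holds at every point, not only almost surely: [unif] never exceeds 1, and 1 is the
    exact mass of the low ray. *)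
Lemma sample_le_bound nu (B : R) i j w : M1 nu -> esssup nu < B%:E ->
  sample nu i j w <= B%:E.
Proof.
move=> nu1 h; apply/quantile_le; first exact: unif_le1.
have h0 := esssup_high_ray0 nu1 h.
have -> : nu (low_ray B%:E) = 1.
  apply/eqP; rewrite eq_le probability_le1 ?andTb; last exact: measurable_low_ray.
  rewrite -(@probability_setT _ _ _ nu).
  have := measurable_low_ray B%:E; have := measurable_high_ray B%:E => mh ml.
  apply: (@le_trans _ _ (nu (low_ray B%:E `|` high_ray B%:E))).
    apply: le_measure; rewrite ?inE //; first exact: measurableU.
    by move=> x _; have [|/ltW] := leP x B%:E; [left|right].
  have : nu (low_ray B%:E `|` high_ray B%:E) <= nu (low_ray B%:E) + nu (high_ray B%:E).
    exact: measureU2.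
  by rewrite h0 adde0.
by rewrite lee_fin unif_le1.
Qed.

(** The margins, 1 in the support bound and the factor 2 in front of [q], are what neighbouring laws
    may consume. [K] is chosen with - K < M - 1, where M is the essential supremum, so that the mass
    of [M - 1, +oo) counts. *)
Lemma M1b_bounds nu : M1b nu -> exists B K q : R,
  [/\ (0 <= B)%R, (0 <= K)%R, (0 < q)%R, esssup nu + 1 < B%:E &
      (2 * q)%:E <= nu (~` low_ray (- K)%:E)].
Proof.
move=> [nu1]; case E : (esssup nu) => [M| |] // _.
have gt0 : 0 < nu (high_ray (M - 1)%:E).
  by apply: esssup_high_ray_gt0; rewrite E lte_fin; lra.
have nuf : nu (high_ray (M - 1)%:E) \is a fin_num.
  by apply: fin_num_measure; exact: measurable_high_ray.
exists (`|M| + 2)%R, (`|M| + 2)%R, (fine (nu (high_ray (M - 1)%:E)) / 2)%R.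
have := ler_norm M; have := ler_norm (- M); rewrite normrN => M1' M2.
split.
- by rewrite addr_ge0.
- by rewrite addr_ge0.
- by rewrite divr_gt0 // fine_gt0 // gt0 ltey_eq nuf.
- by rewrite -EFinD lte_fin; lra.
- rewrite mulrC divfK ?pnatr_eq0 // fineK //.
  apply: le_measure; rewrite ?inE; [exact: measurable_high_ray|exact/measurableC/measurable_low_ray|].
  move=> x; rewrite /high_ray /low_ray /= => Mx; apply/negP; rewrite -ltNge.
  by apply: lt_le_trans Mx; rewrite lte_fin; lra.
Qed.

Definition close_weights (K eps : R) (a a' : \bar R) :=
  ((- K)%:E <= a -> a <= a' + eps%:E) /\ ((- K)%:E <= a' -> a' <= a + eps%:E).

Lemma levy_prokhorov_rays rho nu : compatible_metric rho -> M1 nu ->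
  forall (l : seq R) (eta : R), (0 < eta)%R -> exists2 delta : R, (0 < delta)%R &
  forall nu' : probability (\bar R) R, M1 nu' -> (levy_prokhorov rho nu nu' < delta)%R ->
    forall s : R, s \in l -> nu' (low_ray s%:E) <= nu (low_ray s%:E) + eta%:E /\
      nu' (high_ray s%:E) <= nu (high_ray s%:E) + eta%:E.
Proof.
move=> hrho nu1 l eta eta0; elim: l => [|s l [d d0 IH]]; first by exists 1%R.
have [d1 d10 h1] := levy_prokhorov_closed hrho nu1 (@closed_ereal_ge_ereal R s%:E) eta0.
have [d2 d20 h2] := levy_prokhorov_closed hrho nu1 (@closed_ereal_le_ereal R s%:E) eta0.
exists (Num.min d (Num.min d1 d2)); first by rewrite !lt_min d0 d10 d20.
move=> nu' nu'1; rewrite !lt_min => /and3P[ld l1 l2] t.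
rewrite inE => /orP[/eqP ->|tl]; last exact: IH.
by split; [exact: h1|exact: h2].
Qed.

Lemma M1b_coupling rho nu B K q : compatible_metric rho -> M1b nu ->
  (0 < q)%R -> esssup nu + 1 < B%:E -> (2 * q)%:E <= nu (~` low_ray (- K)%:E) ->
  forall K' eps eta : R, (0 < eps <= 1)%R -> (0 < eta)%R ->
  exists2 delta : R, (0 < delta)%R &
  forall nu' : probability (\bar R) R, M1b nu' -> (M1b_dist rho nu nu' < delta)%R ->
  [/\ esssup nu' < B%:E, q%:E <= nu' (~` low_ray (- K)%:E) &
    forall i j, exists bad : set T, [/\ measurable bad, P bad <= eta%:E &
      forall w, ~ bad w -> close_weights K' (2 * eps) (sample nu i j w) (sample nu' i j w)]].
Proof.
move=> hrho nub q0 hB hq K' eps eta eps01 eta0.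
have /andP[eps0 eps1] := eps01; have [nu1 nuf] := nub.
have [m hm] : exists m : nat, (B + K' + 1 <= m%:R * eps)%R.
  exists (Num.truncn (`|B + K' + 1| / eps)%R).+1.
  rewrite -ler_pdivrMr //; apply: le_trans (ltW (truncnS_gt _)).
  by rewrite ler_pM2r ?invr_gt0 // ler_norm.
pose g k : R := (- (K' + 1) + k%:R * eps)%R.
(* Two bad events for each of the [m.+1] grid points share the total [eta]. *)
pose eta1 := (eta / (m.+1%:R * 2))%R.
have eta10 : (0 < eta1)%R by rewrite divr_gt0 // mulr_gt0.
have [d1 d10 h1] := levy_prokhorov_rays hrho nu1 (map g (iota 0 m.+1)) eta10.
have [d2 d20 h2] := levy_prokhorov_rays hrho nu1 [:: (- K)%R] q0.
(* The 1 matches the margin in [esssup nu + 1 < B]; the distance between essential suprema enters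
   only here. *)
exists (Num.min 1 (Num.min d1 d2))%R; first by rewrite !lt_min ltr01 d10 d20.
move=> nu' [nu'1 nu'f]; rewrite /M1b_dist gt_max !lt_min => /andP[/and3P[_ l1 l2] /andP[dM _]].
have hB' : esssup nu' < B%:E.
  move: hB dM nuf nu'f; case: (esssup nu) => // M; case: (esssup nu') => // M' /=.
  rewrite -EFinD !lte_fin ltr_distlC => h /andP[_ h'] _ _; lra.
split => //.
  have mK := measurable_low_ray (- K)%:E.
  have [h _] := h2 nu' nu'1 l2 (- K)%R (mem_head _ _).
  move: h hq; rewrite !probability_setC //.
  have : nu (low_ray (- K)%:E) \is a fin_num by exact: fin_num_measure.
  have : nu' (low_ray (- K)%:E) \is a fin_num by exact: fin_num_measure.
  case: (nu _) => // a; case: (nu' _) => // b _ _.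
  rewrite -!EFinB -EFinD !lee_fin; lra.
move=> i j.
pose X := sample nu i j; pose X' := sample nu' i j.
(* The estimates on closed sets are one-sided; low and high rays, both closed, together give the two
   comparisons that [grid_close] asks for. *)
pose lowbad k := X' @^-1` low_ray (g k)%:E `\` X @^-1` low_ray (g k)%:E.
pose highbad k := X' @^-1` high_ray (g k)%:E `\` X @^-1` high_ray (g k)%:E.
have mlow n k : measurable (sample n i j @^-1` low_ray (g k)%:E).
  by apply: measurable_sample_preimage; exact: measurable_low_ray.
have mhigh n k : measurable (sample n i j @^-1` high_ray (g k)%:E).
  by apply: measurable_sample_preimage; exact: measurable_high_ray.
have mlb k : measurable (lowbad k) by apply: measurableD; exact: mlow.
have mhb k : measurable (highbad k) by apply: measurableD; exact: mhigh.
have mbad k : measurable (lowbad k `|` highbad k) by apply: measurableU.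
exists (\big[setU/set0]_(k <- iota 0 m.+1) (lowbad k `|` highbad k)); split.
- by apply: bigsetU_measurable => k _.
- have each k : k \in iota 0 m.+1 -> P (lowbad k `|` highbad k) <= (2 * eta1)%:E.
    move=> km; have [hl hh] := h1 nu' nu'1 l1 (g k) (map_f g km).
    apply: (le_trans (measureU2 _ _ _)) => //.
    rewrite mulrC mulr_natr mulr2n EFinD; apply: leeD; apply: nested_setD_le => //.
    + exact: mlow.
    + exact: mlow.
    + exact: sample_low_ray_nested.
    + exact: ltW.
    + by rewrite !unit_prob_sample1 //; exact: measurable_low_ray.
    + exact: mhigh.
    + exact: mhigh.
    + exact: sample_high_ray_nested.
    + exact: ltW.
    + by rewrite !unit_prob_sample1 //; exact: measurable_high_ray.
  apply: le_trans (unit_prob_bigsetU_le mbad each) _; rewrite size_iota.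
  rewrite lee_fin /eta1 le_eqVlt; apply/orP; left; apply/eqP; field.
  by rewrite addrC natr1 pnatr_eq0.
- move=> w; rewrite -bigcup_seq => nb.
  have nb' k : (k <= m)%N -> ~ (lowbad k `|` highbad k) w.
    move=> km bk; have ki : k \in iota 0 m.+1 by rewrite mem_iota.
    by apply: nb; exists k.
  apply: (@grid_close B K' eps m) => //.
  + apply: sample_le_bound => //; apply: le_lt_trans hB.
    by rewrite leeDl.
  + exact: sample_le_bound.
  + move=> k km h; apply: contrapT => nh; apply: (nb' k km); left; split => //.
  + move=> k km h; apply: contrapT => nh; apply: (nb' k km); right; split => //.
Qed.

End levy_prokhorov_coupling.

(** * Mean of the block maximum *)

Section expected_block_maximum.
Set Implicit Arguments.
Unset Strict Implicit.
Import Order.TTheory GRing.Theory Num.Theory.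
Local Open Scope classical_set_scope.
Local Open Scope ring_scope.
Context {R : realType}.
Local Notation T := (measurableTypeR R).
Local Notation P := (@unit_prob R).
Implicit Types (nu : probability (\bar R) R) (s : seq nat).

Definition sample_max nu s (w : T) : R := block_max (fun i j => sample nu i j w) s.

Lemma measurable_sample_max nu s : measurable_fun setT (sample_max nu s).
Proof.
have mpath p : measurable_fun setT (fun w => path_value (fun i j => sample nu i j w) p).
  apply: measurable_fun_ifT => //.
    rewrite /open_path; elim: (path_edges p) => [|e l IH] /=; first exact: measurable_cst.
    apply: measurable_and => //; apply: measurable_neg.
    by apply: measurable_fun_eqe => //; exact: measurable_sample.
  apply: measurable_sum => e; apply: measurableT_comp; first exact: fine_measurable.
  exact: measurable_sample.
rewrite /sample_max /block_max; elim: (index_enum _) => [|m l IH].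
  by under eq_fun do rewrite big_nil; exact: measurable_cst.
under eq_fun do rewrite big_cons.
by apply: measurable_maxr => //; exact: mpath.
Qed.

Definition disconnected nu (K : R) (b a : nat) s : set T :=
  \big[setI/setT]_(v <- s) ~` (sample nu b v @^-1` (~` low_ray (- K)%:E) `&`
                              sample nu v a @^-1` (~` low_ray (- K)%:E)).

Lemma unit_prob_disconnected nu K b a s : uniq s -> b \notin s -> a \notin s ->
  P (disconnected nu K b a s) =
  ((1 - fine (nu (~` low_ray (- K)%:E)) ^+ 2) ^+ size s)%:E.
Proof.
move=> us bs as_; set G := ~` low_ray (- K)%:E; set g := fine (nu G).
have mG : measurable G by apply: measurableC; exact: measurable_low_ray.
pose E v := sample nu b v @^-1` G `&` sample nu v a @^-1` G.
have mE v : measurable (E v) by apply: measurableI; exact: measurable_sample_preimage.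
have mI (l : seq nat) (F : nat -> set T) : (forall v, measurable (F v)) ->
    measurable (\big[setI/setT]_(v <- l) F v).
  by move=> mF; apply: bigsetI_measurable => v _; exact: mF.
have PE (l : seq nat) : uniq l -> b \notin l -> a \notin l ->
    P (\big[setI/setT]_(v <- l) E v) = ((g ^+ 2) ^+ size l)%:E.
  move=> ul bl al.
  have := @unit_prob_sample R nu ([seq (b, v) | v <- l] ++ [seq (v, a) | v <- l]) [::]
    (fun=> G) (fun=> +oo%E) (fun=> mG).
  rewrite cats0 !big_nil setIT mule1 !big_cat !big_map /= -big_split /= => ->; last first.
    rewrite cat_uniq !map_inj_uniq ?ul //=; last 2 first.
    - by move=> u v [].
    - by move=> u v [].
    rewrite andbT; apply/hasPn => _ /mapP [v vl ->]; apply/negP => /mapP [u ul' [_ ua]].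
    by move: al; rewrite ua ul'.
  have -> : nu G = g%:E by rewrite fineK //; exact: fin_num_measure.
  elim: (l) => [|v l' IH]; first by rewrite !big_nil mule1.
  by rewrite !big_cons /= exprS expr2 !EFinM -IH -!muleA [(_ * (g%:E * _))%E]muleCA.
(* Each [E v] involves two edges, so independence is first known for intersections of the [E v].
   Complements enter one at a time through P(A \ E v) = P(A) - P(A and E v). *)
suff : forall s1 s2 : seq nat, uniq (s1 ++ s2) -> b \notin s1 ++ s2 -> a \notin s1 ++ s2 ->
    P (\big[setI/setT]_(v <- s1) ~` E v `&` \big[setI/setT]_(v <- s2) E v) =
    ((1 - g ^+ 2) ^+ size s1 * (g ^+ 2) ^+ size s2)%:E.
  by move=> /(_ s [::]); rewrite cats0 big_nil setIT mulr1; apply.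
elim=> [|v s1 IH] s2 u2 b2 a2.
  by rewrite big_nil setTI PE // expr0 mul1r.
have perm : perm_eq ((v :: s1) ++ s2) (s1 ++ v :: s2).
  by rewrite perm_sym; exact: (permEl (perm_catCA s1 [:: v] s2)).
have H1 : P (\big[setI/setT]_(w <- s1) ~` E w `&` \big[setI/setT]_(w <- v :: s2) E w) =
    ((1 - g ^+ 2) ^+ size s1 * (g ^+ 2) ^+ (size s2).+1)%:E.
  by apply: IH; rewrite -?(perm_uniq perm) -?(perm_mem perm).
have H2 : P (\big[setI/setT]_(w <- s1) ~` E w `&` \big[setI/setT]_(w <- s2) E w) =
    ((1 - g ^+ 2) ^+ size s1 * (g ^+ 2) ^+ size s2)%:E.
  move: u2 b2 a2; rewrite /= !inE !negb_or => /andP[_ u2] /andP[_ b2] /andP[_ a2].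
  exact: IH.
set A := \big[setI/setT]_(w <- s1) ~` E w `&` \big[setI/setT]_(w <- s2) E w in H2 *.
have mA : measurable A by apply: measurableI; apply: mI => // w; exact: measurableC.
rewrite big_cons (_ : _ `&` _ = A `\` E v); last first.
  by rewrite /A setDE -setIA setIC.
have -> : P (A `\` E v) = (P A - P (A `&` E v))%E.
  by rewrite measureD //; rewrite (le_lt_trans (probability_le1 _ _)) ?ltry.
rewrite H2 (_ : A `&` E v = \big[setI/setT]_(w <- s1) ~` E w `&`
    \big[setI/setT]_(w <- v :: s2) E w); last first.
  by rewrite big_cons /A -setIA [_ `&` E v]setIC.
rewrite H1 -EFinB /= !exprS; congr (_%:E); ring.
Qed.

End expected_block_maximum.

(** * Almost additivity of the mean *)

Section block_max_expectation.
Set Implicit Arguments.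
Unset Strict Implicit.
Import Order.TTheory GRing.Theory Num.Theory.
Local Open Scope classical_set_scope.
Local Open Scope ring_scope.
Context {R : realType}.
Local Notation T := (measurableTypeR R).
Local Notation P := (@unit_prob R).
Implicit Types (nu : probability (\bar R) R) (s : seq nat).

Definition disconnected_blocks nu (K : R) s1 s s2 : set T :=
  \big[setU/set0]_(b <- s1) \big[setU/set0]_(a <- s2) disconnected nu K b a s.

Lemma measurable_disconnected nu K b a s : measurable (disconnected nu K b a s).
Proof.
apply: bigsetI_measurable => v _; apply: measurableC.
by apply: measurableI; apply: measurable_sample_preimage; apply: measurableC;
  exact: measurable_low_ray.
Qed.

Lemma measurable_disconnected_blocks nu K s1 s s2 :
  measurable (disconnected_blocks nu K s1 s s2).
Proof.
by apply: bigsetU_measurable => b _; apply: bigsetU_measurable => a _;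
  exact: measurable_disconnected.
Qed.

Lemma connected_blocks nu K s1 s s2 w : ~ disconnected_blocks nu K s1 s s2 w ->
  connected (fun i j => sample nu i j w) K s1 s s2.
Proof.
move=> nd b a bs as_; apply: contrapT => nv; apply: nd.
rewrite /disconnected_blocks -bigcup_seq; exists b => //.
rewrite -bigcup_seq; exists a => //.
rewrite /disconnected -bigcap_seq => v vs [h1 h2]; apply: nv; exists v => //.
move: h1 h2; rewrite /low_ray /= => /negP h1 /negP h2.
by split; apply: ltW; rewrite ltNge.
Qed.

Lemma unit_prob_disconnected_blocks nu K (q : R) s1 s s2 : 0 <= q ->
  (q%:E <= nu (~` low_ray (- K)%:E))%E -> uniq (s1 ++ s ++ s2) ->
  (P (disconnected_blocks nu K s1 s s2) <=
   ((size s1)%:R * ((size s2)%:R * (1 - q ^+ 2) ^+ size s))%:E)%E.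
Proof.
move=> q0 qnu; rewrite !cat_uniq => /and3P[_ /hasPn d1 /and3P[us /hasPn d2 _]].
have mG : measurable (~` low_ray (- K)%:E).
  by apply: measurableC; exact: measurable_low_ray.
have nuf : nu (~` low_ray (- K)%:E) \is a fin_num by exact: fin_num_measure.
apply: unit_prob_bigsetU_le => [b|b bs].
  by apply: bigsetU_measurable => a _; exact: measurable_disconnected.
apply: unit_prob_bigsetU_le => [a|a as_]; first exact: measurable_disconnected.
rewrite unit_prob_disconnected //.
- have g1 : fine (nu (~` low_ray (- K)%:E)) <= 1.
    by rewrite -lee_fin fineK //; exact: probability_le1.
  have qg : q <= fine (nu (~` low_ray (- K)%:E)) by rewrite -lee_fin fineK.
  rewrite lee_fin lerXn2r ?nnegrE //; nra.
- apply/negP => bs'; have := d1 b; rewrite mem_cat bs' => /(_ isT).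
  by rewrite /= bs.
- exact: d2.
Qed.

Definition weight_bounds (B K q : R) nu :=
  [/\ 0 <= B, 0 <= K, 0 < q,
      forall i j w, (sample nu i j w <= B%:E)%E &
      (q%:E <= nu (~` low_ray (- K)%:E))%E].

Definition mean_max nu s : R := \int[P]_w sample_max nu s w.

Lemma sample_max_bounds B K q nu s w : weight_bounds B K q nu ->
  0 <= sample_max nu s w <= (size s)%:R * B.
Proof.
move=> [B0 _ _ hB _]; rewrite block_max_ge0 /=.
by apply: block_max_le_size => // i j; exact: hB.
Qed.

Lemma integrable_bounded (f : T -> R) (M : R) : measurable_fun setT f ->
  (forall w, `|f w| <= M) -> P.-integrable setT (EFin \o f).
Proof.
move=> mf fM; apply: measurable_bounded_integrable => //.
  by rewrite (le_lt_trans (probability_le1 _ _)) ?ltry.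
exists M; split; first exact: num_real.
by move=> x /ltW Mx w _; exact: le_trans (fM w) Mx.
Qed.

Lemma integrable_sample_max B K q nu s : weight_bounds B K q nu ->
  P.-integrable setT (EFin \o sample_max nu s).
Proof.
move=> h; apply: (@integrable_bounded _ ((size s)%:R * B)).
  exact: measurable_sample_max.
by move=> w; have /andP[h0 h1] := sample_max_bounds s w h; rewrite ger0_norm.
Qed.

Lemma mean_indic (A : set T) : measurable A -> \int[P]_w (\1_A w) = fine (P A).
Proof. by move=> mA; rewrite /Rintegral integral_indic // setIT. Qed.

Lemma mean_cst (c : R) : \int[P]_w c = c.
Proof.
have P1 : P setT = 1%E by exact: probability_setT.
by rewrite Rintegral_cst // [X in fine X]P1 mulr1.
Qed.

Lemma integrable_cst (c : R) : P.-integrable setT (EFin \o (fun=> c : R)).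
Proof. by apply: (@integrable_bounded _ `|c|) => //; exact: measurable_cst. Qed.

Lemma mean_le_off_event (f g : T -> R) (A : set T) (c M : R) :
  P.-integrable setT (EFin \o f) -> P.-integrable setT (EFin \o g) ->
  measurable A -> 0 <= M -> (forall w, ~ A w -> f w <= g w + c) ->
  (forall w, f w <= g w + c + M) ->
  \int[P]_w f w <= \int[P]_w g w + c + M * fine (P A).
Proof.
move=> fi gi mA M0 h1 h2.
have i1 : P.-integrable setT (EFin \o (\1_A : T -> R)).
  apply: (@integrable_bounded _ 1); first exact: measurable_indic.
  by move=> w; rewrite indicE; case: (_ \in _); rewrite ?normr1 ?normr0.
have i2 : P.-integrable setT (EFin \o (fun w => M * \1_A w)).
  by have := integrableZl measurableT M i1.
have i3 : P.-integrable setT (EFin \o (fun w => g w + c)).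
  by have := integrableD measurableT gi (integrable_cst c).
rewrite -(mean_indic mA) -RintegralZl // -[X in _ + X + _]mean_cst.
rewrite -RintegralD //; last exact: integrable_cst.
rewrite -RintegralD //; apply: le_Rintegral => //.
  by have := integrableD measurableT i3 i2.
move=> w _; rewrite indicE; have [Aw|Aw] := boolP (w \in A).
  by rewrite mulr1; exact: h2.
by rewrite mulr0 addr0; apply: h1 => Aw'; move/negP: Aw; apply; rewrite inE.
Qed.

Lemma mean_max_cat_le B K q nu s1 s2 : weight_bounds B K q nu ->
  mean_max nu (s1 ++ s2) <= mean_max nu s1 + mean_max nu s2 + B.
Proof.
move=> h; have [B0 _ _ hB _] := h.
have := @mean_le_off_event (sample_max nu (s1 ++ s2))
  (fun w => sample_max nu s1 w + sample_max nu s2 w) set0 B 0.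
rewrite measure0 /= mulr0 addr0 RintegralD //; try exact: integrable_sample_max h.
apply => //.
- exact: integrable_sample_max h.
- by have := integrableD measurableT (integrable_sample_max s1 h) (integrable_sample_max s2 h).
- move=> w _; have := block_max_cat_le s1 s2 B0 (fun i j => hB i j w).
  by rewrite /sample_max; lra.
- move=> w; have := block_max_cat_le s1 s2 B0 (fun i j => hB i j w).
  by rewrite /sample_max; lra.
Qed.

(** The buffer consists of the first [L] vertices of [s2]. Discarding it costs at most
    [L%:R * B + B], joining across it costs [2 * K], and when the connection fails only the crude
    bound by the total size remains. *)
Lemma mean_max_cat_ge B K q nu s1 s2 (L : nat) : weight_bounds B K q nu -> q <= 1 ->
  uniq (s1 ++ s2) ->
  mean_max nu s1 + mean_max nu s2 <= mean_max nu (s1 ++ s2) +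
    (L%:R * B + B + 2 * K) +
    ((size s1)%:R + (size s2)%:R) * B * ((size s1)%:R * ((size s2)%:R * (1 - q ^+ 2) ^+ L)).
Proof.
move=> h q1 u12; have [B0 K0 q0 hB hq] := h.
set S := take L s2; set s2' := drop L s2.
have s2E : s2 = S ++ s2' by rewrite cat_take_drop.
set A := disconnected_blocks nu K s1 S s2'.
have mA : measurable A by exact: measurable_disconnected_blocks.
have q2 : 0 <= 1 - q ^+ 2 by nra.
have PA : fine (P A) <= (size s1)%:R * ((size s2)%:R * (1 - q ^+ 2) ^+ L).
  rewrite -lee_fin fineK; last exact: fin_num_measure.
  apply: le_trans (unit_prob_disconnected_blocks (ltW q0) hq _) _.
    by rewrite -s2E.
  rewrite lee_fin ler_wpM2l // size_drop size_take.
  (* If the buffer exhausts [s2], nothing lies beyond it and no pair can fail to be connected. *)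
  case: ltnP => Ls; first by rewrite ler_wpM2r ?exprn_ge0 // ler_nat leq_subr.
  by rewrite (eqP (_ : (size s2 - L)%N == 0%N)) ?subn_eq0 // mul0r mulr_ge0 ?exprn_ge0.
have H1 w : 0 <= sample_max nu s1 w by have /andP[] := sample_max_bounds s1 w h.
have H2 w : 0 <= sample_max nu (s1 ++ s2) w by have /andP[] := sample_max_bounds (s1 ++ s2) w h.
have H3 w : sample_max nu s1 w <= (size s1)%:R * B by have /andP[] := sample_max_bounds s1 w h.
have H4 w : sample_max nu s2 w <= (size s2)%:R * B by have /andP[] := sample_max_bounds s2 w h.
have LB : 0 <= L%:R * B by rewrite mulr_ge0.
apply: (@le_trans _ _ (mean_max nu (s1 ++ s2) + (L%:R * B + B + 2 * K) +
    ((size s1)%:R + (size s2)%:R) * B * fine (P A))); last first.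
  by rewrite lerD2l ler_wpM2l // mulr_ge0.
rewrite /mean_max -RintegralD //; try exact: integrable_sample_max h.
apply: mean_le_off_event => //.
- by have := integrableD measurableT (integrable_sample_max s1 h) (integrable_sample_max s2 h).
- exact: integrable_sample_max h.
- by rewrite mulr_ge0.
- move=> w nA; have con := connected_blocks nA.
  have J := block_max_join K0 (fun i j => hB i j w) con; rewrite -s2E in J.
  have C := block_max_cat_le S s2' B0 (fun i j => hB i j w); rewrite -s2E in C.
  have D := block_max_le_size S B0 (fun i j => hB i j w).
  have : (size S)%:R * B <= L%:R * B.
    by rewrite ler_wpM2r // ler_nat size_take; case: ltnP.
  by rewrite /sample_max; lra.
- by move=> w; have := H1 w; have := H2 w; have := H3 w; have := H4 w; lra.
Qed.

End block_max_expectation.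

(** * Dyadic scales and comparison of two laws *)

Section dyadic_means.
Set Implicit Arguments.
Unset Strict Implicit.
Import Order.TTheory GRing.Theory Num.Theory.
Local Open Scope classical_set_scope.
Local Open Scope ring_scope.
Context {R : realType}.
Local Notation T := (measurableTypeR R).
Local Notation P := (@unit_prob R).
Implicit Types (nu : probability (\bar R) R) (s : seq nat).

(** Halving an interval produces two intervals with different starting points, so [a] is a parameter
    and the estimates below hold for all [a] at once. *)
Definition dyadic_mean nu a k : R := mean_max nu (iota a (2 ^ k)).

(* With a buffer of length c0 * k, each of the 4^k pairs of vertices fails to be
   connected with probability at most 8^-k, and a failure costs 2^(k+1) * B. *)
Lemma dyadic_mean_succ B K q c0 nu a k : weight_bounds B K q nu -> q <= 1 ->
  (1 - q ^+ 2) ^+ c0 <= 8^-1 ->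
  `|dyadic_mean nu a k.+1 - (dyadic_mean nu a k + dyadic_mean nu (a + 2 ^ k) k)| <=
  (c0%:R * B + 3 * B + 2 * K) * k.+1%:R.
Proof.
move=> h q1 qc; have [B0 K0 q0 _ _] := h.
have q2 : 0 <= 1 - q ^+ 2 by nra.
have E : iota a (2 ^ k.+1) = iota a (2 ^ k) ++ iota (a + 2 ^ k) (2 ^ k).
  by rewrite -iotaD addnn -mul2n -expnS.
have u : uniq (iota a (2 ^ k) ++ iota (a + 2 ^ k) (2 ^ k)) by rewrite -E iota_uniq.
have U := mean_max_cat_le (iota a (2 ^ k)) (iota (a + 2 ^ k) (2 ^ k)) h.
have := mean_max_cat_ge (c0 * k) h q1 u.
rewrite !size_iota exprM.
have F : ((2 ^ k)%:R + (2 ^ k)%:R) * B *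
    ((2 ^ k)%:R * ((2 ^ k)%:R * ((1 - q ^+ 2) ^+ c0) ^+ k)) <= 2 * B.
  rewrite [leLHS](_ : _ = 2 * B * (8 ^+ k * ((1 - q ^+ 2) ^+ c0) ^+ k)); last first.
    rewrite natrX (_ : 8 = 2 * 2 * 2 :> R) ?exprMn; first by ring.
    by rewrite -!natrM.
  rewrite -exprMn -[leRHS]mulr1 ler_wpM2l ?mulr_ge0 //.
  apply: exprn_ile1; first by rewrite mulr_ge0 // exprn_ge0.
  by rewrite mulrC -ler_pdivlMr // div1r.
move=> V; rewrite /dyadic_mean E natrM in V *.
have kB : 0 <= k%:R * B by rewrite mulr_ge0.
have kK : 0 <= k%:R * K by rewrite mulr_ge0.
have cB : 0 <= c0%:R * B by rewrite mulr_ge0.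
by rewrite ler_norml -natr1; apply/andP; split; nra.
Qed.

(** Closed form of the sum of (i + 1) / 2^i over i >= k. *)
Definition dyadic_tail k : R := (k.*2 + 4)%:R / 2 ^+ k.

Lemma dyadic_tail_succ k : dyadic_tail k - dyadic_tail k.+1 = k.+1%:R / 2 ^+ k.
Proof.
rewrite /dyadic_tail -!muln2 !natrD !natrM -natr1 exprS; field.
by rewrite expf_neq0.
Qed.

(** Merging at scale n costs c (n + 1) for each of the two functions; divided by the new length 2^(n
    + 1), this is c times the increment (n + 1) / 2^n of [dyadic_tail]. *)
Lemma dyadic_gap (f f' : nat -> nat -> R) (c delta : R) j :
  (forall a k, `|f a k.+1 - (f a k + f (a + 2 ^ k)%N k)| <= c * k.+1%:R) ->
  (forall a k, `|f' a k.+1 - (f' a k + f' (a + 2 ^ k)%N k)| <= c * k.+1%:R) ->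
  (forall a, `|f a j - f' a j| <= 2 ^+ j * delta) ->
  forall k a, `|f a (j + k)%N - f' a (j + k)%N| <=
    2 ^+ (j + k) * (delta + c * (dyadic_tail j - dyadic_tail (j + k))).
Proof.
move=> hf hf' hj; elim=> [|k IH] a; first by rewrite addn0 subrr mulr0 addr0.
rewrite addnS; set n := (j + k)%N.
have -> : 2 ^+ n.+1 * (delta + c * (dyadic_tail j - dyadic_tail n.+1)) =
    2 * (2 ^+ n * (delta + c * (dyadic_tail j - dyadic_tail n))) + 2 * (c * n.+1%:R).
  have -> : dyadic_tail n.+1 = dyadic_tail n - n.+1%:R / 2 ^+ n.
    by rewrite -dyadic_tail_succ; ring.
  by rewrite exprS; field; rewrite expf_neq0.
have := IH a; have := IH (a + 2 ^ n)%N; have := hf a n; have := hf' a n.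
rewrite -/n !ler_norml => /andP[? ?] /andP[? ?] /andP[? ?] /andP[? ?].
by apply/andP; split; lra.
Qed.

(** The threshold [(size s)%:R * B] is the one below which [block_max_perturb] ignores weights. The
    last term is the largest possible maximum times a union bound over the pairs of vertices. *)
Lemma mean_max_close B K q nu nu' s (eps eta : R) :
  weight_bounds B K q nu -> weight_bounds B K q nu' -> 0 <= eps -> 0 <= eta ->
  (forall i j, exists bad : set T, [/\ measurable bad, (P bad <= eta%:E)%E &
      forall w, ~ bad w -> close_weights ((size s)%:R * B) eps
        (sample nu i j w) (sample nu' i j w)]) ->
  `|mean_max nu s - mean_max nu' s| <=
  (size s)%:R * eps + (size s)%:R * B * ((size s)%:R * ((size s)%:R * eta)).
Proof.
move=> h h' eps0 eta0 hbad.
have [B0 _ _ hB _] := h; have [_ _ _ hB' _] := h'.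
have /choice [bad badP] : forall e : nat * nat, exists A : set T,
    [/\ measurable A, (P A <= eta%:E)%E & forall w, ~ A w -> close_weights ((size s)%:R * B) eps
        (sample nu e.1 e.2 w) (sample nu' e.1 e.2 w)].
  by move=> [i j]; exact: hbad.
pose A := \big[setU/set0]_(i <- s) \big[setU/set0]_(j <- s) bad (i, j).
have mbad e : measurable (bad e) by have [] := badP e.
have mA1 i : measurable (\big[setU/set0]_(j <- s) bad (i, j)).
  by apply: bigsetU_measurable => j _.
have mA : measurable A by apply: bigsetU_measurable => i _.
have PA : fine (P A) <= (size s)%:R * ((size s)%:R * eta).
  rewrite -lee_fin fineK; last exact: fin_num_measure.
  apply: unit_prob_bigsetU_le => // i _; apply: unit_prob_bigsetU_le => // j _.
  by have [] := badP (i, j).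
have close w : ~ A w -> forall i j, i \in s -> j \in s ->
    close_weights ((size s)%:R * B) eps (sample nu i j w) (sample nu' i j w).
  move=> nA i j is_ js; have [_ _ /(_ w)] := badP (i, j); apply => bw; apply: nA.
  by rewrite /A -bigcup_seq; exists i => //; rewrite -bigcup_seq; exists j.
have sB : 0 <= (size s)%:R * B by rewrite mulr_ge0.
have main (mu mu' : probability (\bar R) R) : weight_bounds B K q mu -> weight_bounds B K q mu' ->
    (forall w, ~ A w -> sample_max mu s w <= sample_max mu' s w + (size s)%:R * eps) ->
    mean_max mu s <= mean_max mu' s + (size s)%:R * eps +
      (size s)%:R * B * ((size s)%:R * ((size s)%:R * eta)).
  move=> g g' hA.
  apply: (@le_trans _ _ (mean_max mu' s + (size s)%:R * eps + (size s)%:R * B * fine (P A))).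
    apply: mean_le_off_event => //.
    - exact: integrable_sample_max g.
    - exact: integrable_sample_max g'.
    - move=> w; have /andP[_] := sample_max_bounds s w g.
      have /andP[] := sample_max_bounds s w g'.
      by have : 0 <= (size s)%:R * eps by [rewrite mulr_ge0]; lra.
  by rewrite lerD2l ler_wpM2l.
have := main nu nu' h h'; have := main nu' nu h' h.
have b1 w : ~ A w -> sample_max nu s w <= sample_max nu' s w + (size s)%:R * eps.
  move=> nA; apply: (block_max_perturb B0 eps0 (fun i j => hB i j w) (fun i j => hB' i j w) (lexx _)).
  by move=> i j is_ js; have [] := close w nA i j is_ js.
have b2 w : ~ A w -> sample_max nu' s w <= sample_max nu s w + (size s)%:R * eps.
  move=> nA; apply: (block_max_perturb B0 eps0 (fun i j => hB' i j w) (fun i j => hB i j w) (lexx _)).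
  by move=> i j is_ js; have [] := close w nA i j is_ js.
move=> /(_ b2) m2 /(_ b1) m1.
by rewrite ler_norml; apply/andP; split; lra.
Qed.

Lemma cvg_dyadic_tail : dyadic_tail @ \oo --> (0 : R).
Proof.
(* After multiplication by 2^k, the left side grows by 2 at each step and the right side by at least
   6. *)
have bound k : dyadic_tail k <= 12 * (3 / 4) ^+ k.
  rewrite /dyadic_tail ler_pdivrMr ?exprn_gt0 // -mulrA -exprMn.
  rewrite (_ : 3 / 4 * 2 = 3 / 2 :> R); last by field.
  elim: k => [|k IH]; first by rewrite expr0 mulr1 ler_nat.
  have e1 : 1 <= (3 / 2) ^+ k :> R by apply: exprn_ege1; lra.
  have -> : (k.+1.*2 + 4)%:R = (k.*2 + 4)%:R + 2 :> R by rewrite -natrD addnAC doubleS addn2.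
  by rewrite exprS; lra.
have pos k : 0 <= dyadic_tail k by rewrite divr_ge0 // exprn_ge0.
apply: (@squeeze_cvgr _ _ _ _ (fun=> 0) (fun k => 12 * (3 / 4) ^+ k)).
- by apply: nearW => k; rewrite pos bound.
- exact: cvg_cst.
- rewrite -[X in _ --> X](mulr0 12); apply: cvgMr.
  apply: cvg_expr; rewrite ger0_norm; lra.
Qed.

End dyadic_means.

(** * Convergence to the time constant *)

Section time_constant_mean.
Set Implicit Arguments.
Unset Strict Implicit.
Import Order.TTheory GRing.Theory Num.Theory.
Local Open Scope classical_set_scope.
Local Open Scope ring_scope.
Context {R : realType}.
Local Notation T := (measurableTypeR R).
Local Notation P := (@unit_prob R).
Implicit Types (nu : probability (\bar R) R).

Lemma block_max_iota_middle (x : nat -> nat -> \bar R) B L l :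
  0 <= B -> (forall i j, (x i j <= B%:E)%E) ->
  block_max x (iota 0 (L + l + L).+1) <=
  block_max x (iota (1 + L) l) + (2 * L%:R + 4) * B.
Proof.
move=> B0 xB.
have -> : iota 0 (L + l + L).+1 = iota 0 L.+1 ++ (iota (1 + L) l ++ iota (1 + L + l) L).
  by rewrite -iotaD -[(1 + L)%N]/(0 + L.+1)%N -iotaD addSn addnA.
have := block_max_cat_le (iota 0 L.+1) (iota (1 + L) l ++ iota (1 + L + l) L) B0 xB.
have := block_max_cat_le (iota (1 + L) l) (iota (1 + L + l) L) B0 xB.
have := block_max_le_size (iota 0 L.+1) B0 xB.
have := block_max_le_size (iota (1 + L + l) L) B0 xB.
by rewrite !size_iota -natr1; nra.
Qed.

(** Each of the two failure events pairs one endpoint with at most [n] vertices, hence the factor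
    [2 * n]; the buffers and the joins make up the additive error. *)
Lemma last_passage_near B K q nu L l n : weight_bounds B K q nu -> q <= 1 ->
  (0 < l)%N -> n = (L + l + L).+1 ->
  exists A : set T, [/\ measurable A,
    (P A <= (2 * (n%:R * (1 - q ^+ 2) ^+ L))%:E)%E &
    forall w, ~ A w ->
      ((sample_max nu (iota 0 n) w - ((2 * L%:R + 4) * B + 4 * K))%:E <=
         last_passage (fun i j => sample nu i j w) n)%E /\
      (last_passage (fun i j => sample nu i j w) n <=
         (sample_max nu (iota 0 n) w + ((2 * L%:R + 4) * B + 4 * K))%:E)%E].
Proof.
move=> h q1 l0 nE; have [B0 K0 q0 hB hq] := h.
have q2 : 0 <= 1 - q ^+ 2 by nra.
pose A1 := disconnected_blocks nu K [:: 0%N] (iota 1 L) (iota (1 + L) l).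
pose A2 := disconnected_blocks nu K (iota (1 + L) l) (iota (1 + L + l) L) [:: n].
have m1 : measurable A1 by exact: measurable_disconnected_blocks.
have m2 : measurable A2 by exact: measurable_disconnected_blocks.
exists (A1 `|` A2); split; first exact: measurableU.
- apply: (le_trans (measureU2 _ _ _)) => //.
  have ln : (l%:R : R) <= n%:R by rewrite ler_nat nE; apply: leqW; rewrite -addnAC leq_addl.
  have pw : 0 <= (1 - q ^+ 2) ^+ L by rewrite exprn_ge0.
  rewrite (_ : 2 * _ = n%:R * (1 - q ^+ 2) ^+ L + n%:R * (1 - q ^+ 2) ^+ L); last by ring.
  rewrite EFinD; apply: leeD.
    apply: le_trans (unit_prob_disconnected_blocks (ltW q0) hq _) _.
      by rewrite -iotaD -[[:: 0%N]]/(iota 0 1) -iotaD iota_uniq.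
    by rewrite lee_fin !size_iota /= mul1r ler_wpM2r.
  apply: le_trans (unit_prob_disconnected_blocks (ltW q0) hq _) _.
    rewrite -[[:: n]]/(iota n 1) (_ : n = 1 + L + l + L)%N; last by rewrite nE add1n !addSn.
    by rewrite -!iotaD iota_uniq.
  by rewrite lee_fin !size_iota /= mul1r ler_wpM2r.
- move=> w /not_orP [n1 n2].
  split.
    apply: le_trans (last_passage_ge K0 (fun i j => hB i j w) l0 nE
      (connected_blocks n1) (connected_blocks n2)).
    have := block_max_iota_middle L l B0 (fun i j => hB i j w).
    by rewrite -nE lee_fin /sample_max; lra.
  apply: le_trans (last_passage_le n (fun i j => hB i j w)) _.
  rewrite lee_fin -addn1 iotaD.
  have := block_max_cat_le (iota 0 n) (iota (0 + n) 1) B0 (fun i j => hB i j w).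
  have := block_max_le_size (iota (0 + n) 1) B0 (fun i j => hB i j w).
  have LB : 0 <= L%:R * B by rewrite mulr_ge0.
  by rewrite size_iota /sample_max; lra.
Qed.

(** Guarantees that an interval of length 2^k has room for two buffers of length [c * k] around a
    nonempty block; the proof compares both sides with k^2. *)
Lemma linear_le_exp2 (c k : nat) : (2 * c + 4 <= k)%N -> (2 * (c * k) + 2 <= 2 ^ k)%N.
Proof.
move=> ck; have sq m : (4 <= m)%N -> (m * m <= 2 ^ m)%N.
  elim: m => // m IH; rewrite leq_eqVlt => /orP[/eqP <- //|m4].
  have := IH m4; rewrite expnS; move: m4; nia.
have := sq k (leq_trans (leq_addl _ _) ck).
apply: leq_trans; nia.
Qed.

(** The limit [C] could a priori be infinite; the bounds on [u] exclude it, after which the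
    comparison takes place in the reals. *)
Lemma cvg_sandwich_ereal (u e : nat -> R) (v : nat -> \bar R) (C : \bar R) (M : R) :
  (forall k, 0 <= u k <= M) -> e @ \oo --> (0 : R) -> v @ \oo --> C ->
  (\forall k \near \oo, ((u k - e k)%:E <= v k)%E /\ (v k <= (u k + e k)%:E)%E) ->
  C \is a fin_num /\ u @ \oo --> fine C.
Proof.
move=> uM e0 vC sand.
have e1 : \forall k \near \oo, e k < 1 by apply: (cvgr_lt 0).
have lo : (((- 1)%:E : \bar R) <= C)%E.
  rewrite -(cvg_lim _ vC) //; apply: lime_ge; first exact: cvgP vC.
  near=> k; have [h _] : ((u k - e k)%:E <= v k)%E /\ (v k <= (u k + e k)%:E)%E by near: k.
  apply: le_trans h; rewrite lee_fin; have /andP[u0 _] := uM k.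
  by have : e k < 1; [near: k|lra].
have hi : (C <= (M + 1)%:E)%E.
  rewrite -(cvg_lim _ vC) //; apply: lime_le; first exact: cvgP vC.
  near=> k; have [_ h] : ((u k - e k)%:E <= v k)%E /\ (v k <= (u k + e k)%:E)%E by near: k.
  apply: le_trans h _; rewrite lee_fin; have /andP[_ uM'] := uM k.
  by have : e k < 1; [near: k|lra].
have Cf : C \is a fin_num by move: lo hi; case: (C).
split => //; rewrite -(fineK Cf) in vC.
have fv : (fine \o v) @ \oo --> fine C by exact: fine_cvg.
have d0 : (fun k => u k - fine (v k)) @ \oo --> (0 : R).
  apply: (@squeeze_cvgr _ _ _ _ (fun k => - e k) e) => //.
    near=> k; have [h1 h2] : ((u k - e k)%:E <= v k)%E /\ (v k <= (u k + e k)%:E)%E by near: k.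
    move: h1 h2; case: (v k) => // r; rewrite !lee_fin /= => h1 h2.
    by apply/andP; split; lra.
  by rewrite -oppr0; exact: cvgN.
have -> : u = (fun k => u k - fine (v k)) \+ (fine \o v).
  by apply/funext => k /=; rewrite subrK.
by rewrite -[fine C]add0r; exact: cvgD.
Unshelve. all: by end_near. Qed.

(** Along n = 2^k the failure probabilities are summable, so by Borel-Cantelli the last passage
    weight and the block maximum are eventually close almost surely. The block maximum divided by
    its length is bounded by [B], and dominated convergence passes to the means. *)
Lemma cvg_dyadic_mean B K q c0 nu (C : \bar R) : weight_bounds B K q nu -> q <= 1 ->
  (1 - q ^+ 2) ^+ c0 <= 8^-1 -> is_time_constant nu C ->
  C \is a fin_num /\ (fun k => dyadic_mean nu 0 k / 2 ^+ k) @ \oo --> fine C.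
Proof.
move=> h q1 qc hC; have [B0 K0 q0 hB hq] := h.
have q2 : 0 <= 1 - q ^+ 2 by nra.
pose W w n := last_passage (fun i j => sample nu i j w) n.
pose D k : R := (2 * (c0 * k)%:R + 4) * B + 4 * K.
pose k0 := (2 * c0 + 4)%N.
(* At scale m = k0 + k the failure probability is at most 2 * 2^m * 8^-m = 2 * 4^-m, hence at most 2
   * 2^-k, written as a term of the geometric series summed below. The shift [k0] makes
   [linear_le_exp2] applicable. *)
have /choice [A hA] : forall k, exists A : set T, [/\ measurable A,
    (P A <= (4 / (2 ^ (k + 1))%:R)%:E)%E & forall w, ~ A w ->
      ((sample_max nu (iota 0 (2 ^ (k0 + k))) w - D (k0 + k)%N)%:E <= W w (2 ^ (k0 + k))%N)%E /\
      (W w (2 ^ (k0 + k))%N <= (sample_max nu (iota 0 (2 ^ (k0 + k))) w + D (k0 + k)%N)%:E)%E].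
  move=> k; set m := (k0 + k)%N.
  have := @linear_le_exp2 c0 m (leq_addr _ _) => lin.
  pose l := (2 ^ m - 1 - 2 * (c0 * m))%N.
  have l0 : (0 < l)%N by rewrite /l; move: lin; clear; lia.
  have nE : (2 ^ m = (c0 * m + l + c0 * m).+1)%N by rewrite /l; move: lin; clear; lia.
  have [A [mA PA hA]] := last_passage_near h q1 l0 nE.
  exists A; split => //; apply: le_trans PA _; rewrite lee_fin exprM.
  have p1 : ((1 - q ^+ 2) ^+ c0) ^+ m <= 8^-1 ^+ m.
    by rewrite lerXn2r ?nnegrE ?exprn_ge0 // invr_ge0.
  apply: (@le_trans _ _ (2 * ((2 ^ m)%:R * 8^-1 ^+ m))).
    by rewrite !ler_wpM2l.
  have -> : (2 ^ m)%:R * 8^-1 ^+ m = 4^-1 ^+ m :> R.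
    by rewrite natrX -exprMn; congr (_ ^+ m); field.
  have : 4^-1 ^+ m <= 2^-1 ^+ k :> R.
    rewrite /m exprD; apply: (@le_trans _ _ (1 * 4^-1 ^+ k)).
      by rewrite ler_wpM2r ?exprn_ge0 // exprn_ile1 //; lra.
    by rewrite mul1r lerXn2r ?nnegrE //; lra.
  have -> : 4 / (2 ^ (k + 1))%:R = 2 * 2^-1 ^+ k :> R.
    by rewrite natrX exprD expr1 exprVn; field; rewrite expf_neq0.
  by rewrite ler_pM2l.
have mA k : measurable (A k) by have [] := hA k.
have N0 : P (lim_sup_set A) = 0%E.
  apply: lim_sup_set_cvg0 => //.
  apply: (@le_lt_trans _ _ (\sum_(0 <= k <oo) (4 / (2 ^ (k + 1))%:R)%:E)%E).
    by apply: lee_nneseries => k _ //; have [] := hA k.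
  by rewrite (cvg_lim _ (@cvg_geometric_eseries_half R 4 0)) // ltry.
pose u w k := sample_max nu (iota 0 (2 ^ k)) w / 2 ^+ k.
have ub w k : 0 <= u w k <= B.
  have /andP[h0 h1] := sample_max_bounds (iota 0 (2 ^ k)) w h.
  rewrite /u divr_ge0 ?exprn_ge0 //= ler_pdivrMr ?exprn_gt0 // mulrC.
  by move: h1; rewrite size_iota natrX.
have D0 : (fun k => D k / 2 ^+ k) @ \oo --> (0 : R).
  apply: (@squeeze_cvgr _ _ _ _ (fun=> 0) (fun k => (c0%:R * B + B + K) * dyadic_tail k)).
  - apply: nearW => k; rewrite divr_ge0 ?exprn_ge0 //=; last first.
      by rewrite addr_ge0 ?mulr_ge0 // addr_ge0 // mulr_ge0.
    rewrite /dyadic_tail mulrA ler_pM2r ?invr_gt0 ?exprn_gt0 // /D -muln2 !natrD !natrM.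
    have kB : 0 <= k%:R * B by rewrite mulr_ge0.
    have kK : 0 <= k%:R * K by rewrite mulr_ge0.
    have cB : 0 <= c0%:R * B by rewrite mulr_ge0.
    by nra.
  - exact: cvg_cst.
  - rewrite -[X in _ --> X](mulr0 (c0%:R * B + B + K)); apply: cvgMr.
    exact: cvg_dyadic_tail.
have ae_lim : {ae P, forall w, C \is a fin_num /\ u w @ \oo --> fine C}.
  have aeC := hC _ _ _ _ (iid_sample nu).
  have aeN : {ae P, forall w, ~ lim_sup_set A w}.
    exists (lim_sup_set A); split => //; last by move=> w /contrapT.
    by apply: bigcapT_measurable => n; apply: bigcup_measurable => k _.
  apply: filterS2 aeC aeN => w cw nw.
  have sub : (fun k => W w (2 ^ k)%N * (((2 ^ k)%:R : R)^-1)%:E)%E @ \oo --> C.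
    have e2 : (fun k => 2 ^ k)%N @ \oo --> \oo.
      apply/cvgnyPge => m; near=> k; apply: (@leq_trans k); first by near: k; exact: nbhs_infty_ge.
      by apply: ltnW; exact: ltn_expl.
    exact: (cvg_comp _ _ e2 cw).
  apply: (cvg_sandwich_ereal (ub w) D0 sub).
  have [m hm] : exists m, forall j, (m <= j)%N -> ~ A j w.
    apply: contrapT => nex; apply: nw => n _; apply: contrapT => nb; apply: nex.
    by exists n => j nj Aj; apply: nb; exists j.
  near=> k.
  have kE : (k = k0 + (k - k0))%N by rewrite subnKC //; near: k; exact: nbhs_infty_ge.
  have km : (m <= k - k0)%N by rewrite leq_subRL; near: k; exact: nbhs_infty_ge.
  have [_ _ /(_ w (hm _ km))] := hA (k - k0)%N.
  rewrite -kE => -[s1 s2].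
  have p0 : (0 <= ((2 ^ k)%:R : R)^-1%:E)%E by rewrite lee_fin invr_ge0.
  rewrite /u -mulrBl -mulrDl -natrX !EFinM.
  by split; apply: lee_wpmul2r.
have Cf : C \is a fin_num.
  (* Finiteness of [C] does not depend on [w]: if it failed, the null exceptional set would be the
     whole space. *)
  apply: contrapT => nC; have [N [mN PN sub]] := ae_lim.
  have : (P setT <= P N)%E.
    by apply: le_measure; rewrite ?inE //; apply: subset_trans sub => w _ [].
  by rewrite PN probability_setT lee_fin ler10.
split => //.
have mu_ k : measurable_fun setT (fun w => u w k).
  by apply: measurable_funM; [exact: measurable_sample_max|exact: measurable_cst].
have f_f : {ae P, forall w, setT w -> (fun k => (u w k)%:E) @ \oo --> (fine C)%:E}.
  apply: filterS ae_lim => w [_ uC] _; apply: cvg_EFin => //; exact: nearW.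
have f_g : {ae P, forall w k, setT w -> (`|(u w k)%:E| <= B%:E)%E}.
  apply: aeW => w k _; have /andP[u0 uB] := ub w k.
  by rewrite abse_EFin lee_fin ger0_norm.
have [_ _] := dominated_convergence measurableT (fun k => (measurable_EFinP _ _).2 (mu_ k))
   (measurable_cst (fine C)%:E) f_f (integrable_cst B) f_g.
rewrite [X in _ --> X](_ : _ = (fine C)%:E); last first.
  have P1 : P setT = 1%E by exact: probability_setT.
  by rewrite integral_cst // [X in (_ * X)%E]P1 mule1.
move=> cv; have {}cv := fine_cvg cv.
rewrite (_ : (fun k => dyadic_mean nu 0 k / 2 ^+ k) =
  fine \o (fun k => \int[P]_w (u w k)%:E)%E); first exact: cv.
apply/funext => k /=; rewrite /dyadic_mean /mean_max -RintegralZr //.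
exact: integrable_sample_max h.
Unshelve. all: by end_near. Qed.

End time_constant_mean.

(** * Continuity *)

Section continuity.
Set Implicit Arguments.
Unset Strict Implicit.
Import Order.TTheory GRing.Theory Num.Theory.
Local Open Scope classical_set_scope.
Local Open Scope ring_scope.
Context {R : realType}.
Implicit Types (nu : probability (\bar R) R).

Lemma exists_buffer_length (q : R) : 0 < q -> q <= 1 ->
  exists c0, (1 - q ^+ 2) ^+ c0 <= 8^-1.
Proof.
move=> q0 q1; have q2 : 0 <= 1 - q ^+ 2 by nra.
have cv : (fun n => (1 - q ^+ 2) ^+ n) @ \oo --> (0 : R).
  by apply: cvg_expr; rewrite ger0_norm //; nra.
have [n _ /(_ n (leqnn n))] : \forall n \near \oo, (1 - q ^+ 2) ^+ n < 8^-1.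
  by apply: (cvgr_lt 0).
by move=> /ltW ?; exists n.
Qed.

(** The limit of [dyadic_gap] as the larger scale tends to infinity with [j] fixed; the subtracted
    tail is nonnegative and is dropped. *)
Lemma time_constant_gap B K q c0 nu nu' (C C' : \bar R) (delta : R) j :
  weight_bounds B K q nu -> weight_bounds B K q nu' -> q <= 1 ->
  (1 - q ^+ 2) ^+ c0 <= 8^-1 -> is_time_constant nu C -> is_time_constant nu' C' ->
  (forall a, `|dyadic_mean nu a j - dyadic_mean nu' a j| <= 2 ^+ j * delta) ->
  `|fine C - fine C'| <= delta + (c0%:R * B + 3 * B + 2 * K) * dyadic_tail j.
Proof.
move=> h h' q1 qc hC hC' hj; have [B0 K0 q0 _ _] := h.
have [_ cv] := cvg_dyadic_mean h q1 qc hC.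
have [_ cv'] := cvg_dyadic_mean h' q1 qc hC'.
set c := _ + _ + _.
have c0' : 0 <= c by rewrite /c !addr_ge0 ?mulr_ge0.
have gap := dyadic_gap (fun a k => dyadic_mean_succ a k h q1 qc)
  (fun a k => dyadic_mean_succ a k h' q1 qc) hj.
have cvd : (fun k => `|dyadic_mean nu 0 k / 2 ^+ k - dyadic_mean nu' 0 k / 2 ^+ k|) @ \oo -->
    `|fine C - fine C'|.
  by apply: cvg_norm; exact: cvgB.
rewrite -(cvg_lim _ cvd) //; apply: limr_le; first exact: cvgP cvd.
near=> k.
have kE : (k = j + (k - j))%N by rewrite subnKC //; near: k; exact: nbhs_infty_ge.
rewrite kE -mulrBl normrM normfV ler_pdivrMr ?normr_gt0 ?expf_neq0 //.
rewrite [X in _ * X]ger0_norm ?exprn_ge0 // mulrC; apply: le_trans (gap _ _) _.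
rewrite ler_wpM2l ?exprn_ge0 // lerD2l ler_wpM2l // gerBl.
by rewrite divr_ge0 // exprn_ge0.
Unshelve. all: by end_near. Qed.

Lemma time_constant_continuous (rho : \bar R -> \bar R -> R)
    (C : probability (\bar R) R -> \bar R) :
  compatible_metric rho -> (forall nu, M1b nu -> is_time_constant nu (C nu)) ->
  forall nu, M1b nu -> C nu \is a fin_num /\
  forall eps : R, 0 < eps -> exists2 delta : R, 0 < delta &
    forall nu', M1b nu' -> M1b_dist rho nu nu' < delta ->
      C nu' \is a fin_num /\ `|fine (C nu) - fine (C nu')| < eps.
Proof.
move=> hrho hC nu nub; have [nu1 _] := nub.
have [B [K [q [B0 K0 q0 hB hq]]]] := M1b_bounds nub.
have q1 : q <= 1.
  have : (nu (~` low_ray (- K)%:E) <= 1)%E.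
    by apply: probability_le1; apply: measurableC; exact: measurable_low_ray.
  by move=> /(le_trans hq); rewrite lee_fin; lra.
have hB' : (esssup nu < B%:E)%E.
  by apply: le_lt_trans hB; rewrite leeDl.
have h : weight_bounds B K q nu.
  split => //; first by move=> i j w; exact: sample_le_bound.
  by apply: le_trans hq; rewrite lee_fin; lra.
have [c0 qc] := exists_buffer_length q0 q1.
have [Cf _] := cvg_dyadic_mean h q1 qc (hC nu nub).
split => // eps eps0.
set c := c0%:R * B + 3 * B + 2 * K.
have c0' : 0 <= c by rewrite /c !addr_ge0 ?mulr_ge0.
(* The scale comes first: [c] depends only on bounds shared with the neighbouring laws, so [j] is
   fixed before [delta] is chosen. *)
have [j hj] : exists j, (c * dyadic_tail j < eps / 2 :> R).
  have cv : (fun j => c * dyadic_tail j) @ \oo --> (0 : R).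
    by rewrite -[X in _ --> X](mulr0 c); apply: cvgMr; exact: cvg_dyadic_tail.
  have [n _ /(_ n (leqnn n))] : \forall n \near \oo, c * dyadic_tail n < eps / 2.
    by apply: (cvgr_lt 0) => //; rewrite divr_gt0.
  by exists n.
set N : R := (2 ^ j)%:R; have N0 : 0 < N by rewrite ltr0n expn_gt0.
(* In [mean_max_close], [2 * e1] and [eta] each contribute at most [eps / 8] per vertex. The minimum
   with 1 is the mesh condition of the grid, and [B + 1] avoids a division by 0. *)
pose e1 := Num.min 1 (eps / 16).
pose eta := eps / (8 * (B + 1) * N * N).
have e1_pos : 0 < e1 <= 1 by rewrite lt_min ltr01 divr_gt0 //= ge_min lexx.
have B1 : 0 < B + 1 by lra.
have eta0 : 0 < eta by rewrite divr_gt0 // !mulr_gt0.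
have [delta delta0 hd] := M1b_coupling hrho nub q0 hB hq (N * B) e1_pos eta0.
exists delta => // nu' nub' dist; have [nu'1 _] := nub'.
have [es qn bad] := hd nu' nub' dist.
have h' : weight_bounds B K q nu'.
  by split => // i j' w; exact: sample_le_bound.
have [Cf' _] := cvg_dyadic_mean h' q1 qc (hC nu' nub').
split => //.
have step a : `|dyadic_mean nu a j - dyadic_mean nu' a j| <= 2 ^+ j * (eps / 4).
  have e10 : 0 <= 2 * e1 by have /andP[] := e1_pos; lra.
  have := @mean_max_close _ B K q nu nu' (iota a (2 ^ j)) (2 * e1) eta h h' e10 (ltW eta0).
  rewrite size_iota -/N => /(_ bad) /le_trans; apply.
  rewrite -natrX -/N.
  have -> : N * (2 * e1) + N * B * (N * (N * eta)) = N * (2 * e1 + B / (8 * (B + 1)) * eps).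
    by rewrite /eta; field; rewrite !gt_eqF.
  rewrite ler_wpM2l ?(ltW N0) //.
  have : e1 <= eps / 16 by rewrite ge_min lexx orbT.
  have : B / (8 * (B + 1)) * eps <= 1 / 8 * eps.
    rewrite ler_wpM2r ?(ltW eps0) // ler_pdivrMr ?mulr_gt0 //; lra.
  lra.
have := time_constant_gap h h' q1 qc (hC nu nub) (hC nu' nub') step.
by rewrite -/c => /le_lt_trans; apply; lra.
Qed.

End continuity.

Theorem theorem1p3 (R : realType) (rho : \bar R -> \bar R -> R)
    (hrho : compatible_metric rho)
    (C : probability (\bar R) R -> \bar R)
    (hC : forall nu : probability (\bar R) R,
       M1b nu -> is_time_constant nu (C nu)) :
  forall nu : probability (\bar R) R, M1b nu ->
  forall V : set (\bar R), nbhs (C nu) V ->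
  exists2 delta : R, (0 < delta)%R &
    forall nu' : probability (\bar R) R, M1b nu' ->
      (M1b_dist rho nu nu' < delta)%R -> V (C nu').
Proof.
move=> nu nub V nV.
have [Cf hc] := time_constant_continuous hrho hC nub.
have [e e0 he] : exists2 e : R, (0 < e)%R &
    forall r : R, (`|fine (C nu) - r| < e)%R -> V r%:E.
  have /nbhs_ballP [e /= e0 he] : nbhs (fine (C nu)) (EFin @^-1` V)%classic.
    by move: nV; rewrite -{1}(fineK Cf).
  by exists e => // r hr; exact: he.
have [delta d0 hd] := hc e e0.
exists delta => // nu' nub' dist.
have [Cf' close] := hd nu' nub' dist.
by rewrite -(fineK Cf'); exact: he.
Qed.
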